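(* Let $(X_n)_{n\ge 0}$ be a simple random walk on $\mathbb{Z}^4$. Then $$\lim_{n\to\infty}\frac{\operatorname{Var}\big(\operatorname{Cap}(X[0,n])\big)}{\big(\mathbb{E}[\operatorname{Cap}(X[0,n])]\big)^2}=0,$$ and consequently $$\frac{\operatorname{Cap}(X[0,n])}{\mathbb{E}[\operatorname{Cap}(X[0,n])]}\longrightarrow 1\quad\text{in probability as } n\to\infty.$$
   Context: The simple random walk on $\mathbb{Z}^d$ is the nearest-neighbour walk that at each step jumps to one of the $2d$ neighbours with probability $1/(2d)$ each; it starts from a deterministic point (e.g. the origin). $\mathbb{P}^x$ denotes the law of the walk started from $x$. The range up to time $n$ is the random set $X[0,n]=\{X_0,X_1,\ldots,X_n\}$. For a finite set $F\subset\mathbb{Z}^d$ ($d\ge 3$), its capacity is the sum of escape probabilities $$\operatorname{Cap}(F)=\sum_{x\in F}\mathbb{P}^x[X_m\notin F\ \text{for all } m\ge 1].$$ The quantity $\operatorname{Cap}(X[0,n])$ is the random variable obtained by evaluating this set function at the random set $X[0,n]$; $\operatorname{Var}$ and $\mathbb{E}$ are taken with respect to the law of $X$. *)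

(* Defs.v *)
From HB Require Import structures.
From mathcomp Require Import all_boot all_order all_algebra finmap.
From mathcomp Require Import all_classical all_reals all_analysis.

Set Implicit Arguments.
Unset Strict Implicit.
Unset Printing Implicit Defensive.

Import Order.TTheory GRing.Theory Num.Theory.
Import numFieldNormedType.Exports.

Local Open Scope classical_set_scope.
Local Open Scope ring_scope.

Definition neighbour (d : nat) (y z : 'rV[int]_d) : bool :=
  [exists i : 'I_d, (z == y + delta_mx 0 i) || (z == y - delta_mx 0 i)].

Definition srw_step (R : realType) (d : nat) (y z : 'rV[int]_d) : R :=
  if neighbour y z then (2 * d)%N%:R^-1 else 0.

(* [srw_jump] says that, conditionally on any trajectory p_0, ..., p_n of
   positive probability, the next position has law [srw_step (p n)]; it is
   written as a product so that trajectories of probability 0 are harmless.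
   Since 'rV[int]_d is countable, [srw_meas] is measurability of X_n for the
   discrete sigma-algebra. *)
Record is_srw (R : realType) (disp : measure_display) (T : measurableType disp)
    (P : probability T R) (d : nat) (X : nat -> T -> 'rV[int]_d)
    (x : 'rV[int]_d) : Prop := IsSRW {
  srw_meas : forall (n : nat) (z : 'rV[int]_d), measurable [set w | X n w = z];
  srw_start : P [set w | X 0%N w = x] = 1%E;
  srw_jump : forall (n : nat) (p : nat -> 'rV[int]_d) (z : 'rV[int]_d),
    P [set w | (forall i, (i <= n)%N -> X i w = p i) /\ X n.+1 w = z] =
    (P [set w | forall i, (i <= n)%N -> X i w = p i]
      * (srw_step R (p n) z)%:E)%E
}.

(* A realisation of the laws P^x of the walk: one process Y which, for every x,
   is a simple random walk started from x under the measure Px x. *)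
Definition srw_family (R : realType) (disp : measure_display)
    (Omega : measurableType disp) (d : nat)
    (Px : 'rV[int]_d -> probability Omega R) (Y : nat -> Omega -> 'rV[int]_d) : Prop :=
  forall x : 'rV[int]_d, is_srw (Px x) Y x.

Definition escape (R : realType) (disp : measure_display)
    (Omega : measurableType disp) (d : nat)
    (Px : 'rV[int]_d -> probability Omega R) (Y : nat -> Omega -> 'rV[int]_d)
    (F : {fset 'rV[int]_d}) (x : 'rV[int]_d) : R :=
  fine (Px x [set w | forall m : nat, (1 <= m)%N -> Y m w \notin F]).

Definition capacity (R : realType) (disp : measure_display)
    (Omega : measurableType disp) (d : nat)
    (Px : 'rV[int]_d -> probability Omega R) (Y : nat -> Omega -> 'rV[int]_d)
    (F : {fset 'rV[int]_d}) : R :=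
  \sum_(x <- F) escape Px Y F x.

Definition walk_range (T : Type) (d : nat) (X : nat -> T -> 'rV[int]_d)
    (n : nat) (w : T) : {fset 'rV[int]_d} :=
  [fset X i w | i in iota 0 n.+1]%fset.

Definition cvg_in_probability (R : realType) (disp : measure_display)
    (T : measurableType disp) (P : probability T R)
    (f : nat -> T -> R) (l : R) : Prop :=
  forall eps : R, 0 < eps ->
    P [set w | eps < `|f n w - l|] @[n --> \oo] --> 0%E.

(* Main.v *)
Require Import Defs.
From HB Require Import structures.
From mathcomp Require Import all_boot all_order all_algebra finmap.
From mathcomp Require Import all_classical all_reals all_analysis.
From mathcomp Require Import measurable_realfun.
From mathcomp Require Import ring lra zify.

Import Order.TTheory GRing.Theory Num.Theory.
Import numFieldNormedType.Exports.

Local Open Scope classical_set_scope.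
Local Open Scope ring_scope.

(** The proof compares the capacity C_n of the range with itself at two scales.
    Cut the walk of a + b steps at time a. The two pieces are independent, and
    capacity is subadditive and translation invariant, so C_(a+b) is at most a
    sum of independent copies of C_a and C_b ([walkcap_cat]). Writing m_n and
    V_n for the mean and the variance of C_n, this gives

      V_(a+b) <= V_a + V_b + (m_a + m_b)^2 - m_(a+b)^2     ([var_cap_add]).

    If moreover m_(a+b) is close to m_a + m_b when a and b are about n/2, the
    ratio V_n / m_n^2 is at most a fixed factor below 1 times the larger of its
    values at a and b, plus a vanishing error, and it tends to 0
    ([var_cap_ratio_step], [halving_recursion]). So only the means have to be
    understood, and only up to constants: m_n must be of order n / log n.

    Near additivity. For two sets A and B with equilibrium measures e_A and
    e_B, cap A + cap B - cap (A u B) is at most 2 <e_A, G e_B>, where G is the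
    Green function ([cap_energy]). Let A and B be the two halves of the range.
    The first and last eps n points of B contribute at most the capacity of a
    walk of length eps n, since G e_A <= 1. A point of B visited at another
    time j carries, in e_B, at most the escape probability from the window of
    radius L = eps n around j. This is a function of the window only, of mean
    at most m_L / L = O(1 / log n), and given the window the Green function
    between that point and any fixed point has mean O(1 / L). Hence these
    points contribute at most m_a (n / L) O(1 / log n) in mean, and the total
    defect is an arbitrarily small fraction of m_n ([energy_le],
    [mean_cap_almost_additive], [mean_cap_defect]).

    Order of the mean. The potential of the equilibrium measure e of the range
    is 1 on the range, so n + 1 is the sum of e(y) D(y), where D is the
    potential of the occupation measure. Cauchy-Schwarz for the energy form,
    whose occupation energy has mean O(n log n), gives the lower bound of m_n
    ([cap_lower], [mean_cap_ge]). For the upper bound, D at the position at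
    time k dominates the self-potential of the walk restarted at time k, which
    has mean of order log n and variance O(log n); by Chebyshev it is at least
    c log n except with probability O(1 / log n) ([self_potential_sqr],
    [walkcap_upper], [mean_cap_le]).

    These estimates rest on p_n(x) = O(n^(-2)) and on a matching lower bound
    for return probabilities at even times ([hk_le], [hk_lower]). As all the
    quantities depend on finitely many steps, they are finite averages over
    step sequences; the given probability spaces enter only at the end, where
    their integrals and escape probabilities are identified with these averages
    ([integral_hist], [escape_esc]). *)

(** * Finite averages over step sequences *)

Definition step : Type := ('I_4 * bool)%type.

Definition step_vec (e : step) : 'rV[int]_4 :=
  if e.2 then delta_mx 0 e.1 else - delta_mx 0 e.1.

Definition pos (s : seq step) : 'rV[int]_4 := \sum_(e <- s) step_vec e.

(** Reversing a step turns the walk into its opposite in law; every use of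
    the symmetry of the walk goes through this involution. *)
Definition flip (e : step) : step := (e.1, ~~ e.2).

(** Expectation for n independent uniform steps. The recursion puts the first
    step on the outside, so that the Markov property at a fixed time is the
    concatenation lemma [Ex_cat]. *)
Fixpoint Ex {R : realFieldType} (n : nat) (F : seq step -> R) : R :=
  if n is m.+1 then 8%:R^-1 * \sum_(e : step) Ex m (fun s => F (e :: s))
  else F [::].

Lemma card_step : #|{: step}| = 8.
Proof. by rewrite card_prod card_ord card_bool. Qed.

Lemma pos_nil : pos [::] = 0. Proof. by rewrite /pos big_nil. Qed.

Lemma pos_cons e s : pos (e :: s) = step_vec e + pos s.
Proof. by rewrite /pos big_cons. Qed.

Lemma pos_cat s t : pos (s ++ t) = pos s + pos t.
Proof. by rewrite /pos big_cat. Qed.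

Lemma step_vec_flip e : step_vec (flip e) = - step_vec e.
Proof. by case: e => i [] //=; rewrite /step_vec /= opprK. Qed.

Lemma pos_flip s : pos (map flip s) = - pos s.
Proof.
rewrite /pos big_map -sumrN; apply: eq_bigr => e _; exact: step_vec_flip.
Qed.

Lemma flipK : involutive flip.
Proof. by case=> i b; rewrite /flip /= negbK. Qed.

Lemma Ex_ext (R : realFieldType) n (F G : seq step -> R) :
  (forall s, size s = n -> F s = G s) -> Ex n F = Ex n G.
Proof.
elim: n F G => [|n IH] F G FG /=; first exact: FG.
by congr (_ * _); apply: eq_bigr => e _; apply: IH => s ss; apply: FG; rewrite /= ss.
Qed.

Lemma Ex_le (R : realFieldType) n (F G : seq step -> R) :
  (forall s, size s = n -> F s <= G s) -> Ex n F <= Ex n G.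
Proof.
elim: n F G => [|n IH] F G FG /=; first exact: FG.
rewrite ler_wpM2l ?invr_ge0 ?ler0n //; apply: ler_sum => e _.
by apply: IH => s ss; apply: FG; rewrite /= ss.
Qed.

Lemma Ex_cst (R : realFieldType) n (c : R) : Ex n (fun=> c) = c.
Proof.
elim: n => [//|n IH] /=; rewrite (eq_bigr (fun=> c)); last by move=> e _.
by rewrite big_const iter_addr_0 card_step -[c *+ 8]mulr_natl mulrA mulVf ?mul1r ?pnatr_eq0.
Qed.

Lemma Ex_ge0 (R : realFieldType) n (F : seq step -> R) :
  (forall s, size s = n -> 0 <= F s) -> 0 <= Ex n F.
Proof. by move=> F0; rewrite -(Ex_cst R n 0); apply: Ex_le. Qed.

Lemma ExD (R : realFieldType) n (F G : seq step -> R) :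
  Ex n (fun s => F s + G s) = Ex n F + Ex n G.
Proof.
elim: n F G => [//|n IH] F G /=; rewrite -mulrDr -big_split /=; congr (_ * _).
by apply: eq_bigr => e _; rewrite -IH.
Qed.

Lemma ExZ (R : realFieldType) n (c : R) (F : seq step -> R) :
  Ex n (fun s => c * F s) = c * Ex n F.
Proof.
elim: n F => [//|n IH] F /=; rewrite [RHS]mulrCA; congr (_ * _).
by rewrite big_distrr /=; apply: eq_bigr => e _; rewrite -IH.
Qed.

Lemma ExZr (R : realFieldType) n (c : R) (F : seq step -> R) :
  Ex n (fun s => F s * c) = Ex n F * c.
Proof. by rewrite mulrC -ExZ; apply: Ex_ext => s _; rewrite mulrC. Qed.

Lemma ExN (R : realFieldType) n (F : seq step -> R) :
  Ex n (fun s => - F s) = - Ex n F.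
Proof. by rewrite -mulN1r -ExZ; apply: Ex_ext => s _; rewrite mulN1r. Qed.

Lemma ExB (R : realFieldType) n (F G : seq step -> R) :
  Ex n (fun s => F s - G s) = Ex n F - Ex n G.
Proof. by rewrite ExD ExN. Qed.

Lemma Ex_sum (R : realFieldType) n (I : Type) (r : seq I) (P : pred I)
    (F : I -> seq step -> R) :
  Ex n (fun s => \sum_(i <- r | P i) F i s) = \sum_(i <- r | P i) Ex n (F i).
Proof.
elim: r => [|i r IH].
  by rewrite big_nil -[RHS](Ex_cst R n); apply: Ex_ext => s _; rewrite big_nil.
rewrite big_cons; case: ifPn => Pi.
  by rewrite -IH -ExD; apply: Ex_ext => s _; rewrite big_cons Pi.
by rewrite -IH; apply: Ex_ext => s _; rewrite big_cons (negbTE Pi).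
Qed.

Lemma Ex_cat (R : realFieldType) m n (F : seq step -> R) :
  Ex (m + n) F = Ex m (fun s => Ex n (fun t => F (s ++ t))).
Proof.
elim: m F => [//|m IH] F; rewrite addSn /=; congr (_ * _).
by apply: eq_bigr => e _; rewrite IH.
Qed.

Lemma Ex_swap (R : realFieldType) m n (F : seq step -> seq step -> R) :
  Ex m (fun s => Ex n (F s)) = Ex n (fun t => Ex m (fun s => F s t)).
Proof.
elim: m F => [//|m IH] F /=; rewrite ExZ; congr (_ * _).
by rewrite Ex_sum; apply: eq_bigr => e _; rewrite IH.
Qed.

(** The Markov property at time j: what happens before and what happens after
    are independent. *)
Lemma Ex_split (R : realFieldType) j n (F : seq step -> seq step -> R) :
  (j <= n)%N ->
  Ex n (fun s => F (take j s) (drop j s)) = Ex j (fun s => Ex (n - j) (F s)).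
Proof.
move=> jn; rewrite -{1}(subnKC jn) Ex_cat; apply: Ex_ext => s ss.
by apply: Ex_ext => t _; rewrite -ss take_size_cat // drop_size_cat.
Qed.

Lemma Ex_take (R : realFieldType) j n (F : seq step -> R) :
  (j <= n)%N -> Ex n (fun s => F (take j s)) = Ex j F.
Proof.
move=> jn; rewrite (Ex_split R j n (fun s _ => F s) jn).
by apply: Ex_ext => s _; rewrite Ex_cst.
Qed.

Lemma Ex_drop (R : realFieldType) j n (F : seq step -> R) :
  (j <= n)%N -> Ex n (fun s => F (drop j s)) = Ex (n - j) F.
Proof. by move=> jn; rewrite (Ex_split R j n (fun _ s => F s) jn) Ex_cst. Qed.

Lemma Ex_flip (R : realFieldType) n (F : seq step -> R) :
  Ex n (fun s => F (map flip s)) = Ex n F.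
Proof.
elim: n F => [//|n IH] F /=; congr (_ * _).
rewrite [RHS](reindex_inj (inv_inj flipK)) /=; apply: eq_bigr => e _.
by rewrite -[RHS]IH.
Qed.

Lemma Ex_posN (R : realFieldType) n (f : 'rV[int]_4 -> R) :
  Ex n (fun s => f (- pos s)) = Ex n (fun s => f (pos s)).
Proof. by rewrite -[RHS]Ex_flip; apply: Ex_ext => s _; rewrite pos_flip. Qed.

Lemma Ex_sqr (R : realFieldType) n (F : seq step -> R) (m : R) :
  Ex n (fun s => (F s - m) ^+ 2)
  = Ex n (fun s => F s ^+ 2) - m * (2 * Ex n F) + m ^+ 2.
Proof.
rewrite -!ExZ -(Ex_cst R n (m ^+ 2)) -ExB -ExD; apply: Ex_ext => s _; ring.
Qed.

(** * Transition probabilities *)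

Definition hk {R : realFieldType} (n : nat) (x : 'rV[int]_4) : R :=
  Ex n (fun s => (pos s == x)%:R).

Lemma hk_ge0 (R : realFieldType) n x : 0 <= hk n x :> R.
Proof. by apply: Ex_ge0 => s _; rewrite ler0n. Qed.

Lemma hk0 (R : realFieldType) x : hk 0 x = (x == 0)%:R :> R.
Proof. by rewrite /hk /= pos_nil eq_sym. Qed.

Lemma hkN (R : realFieldType) n x : hk n (- x) = hk n x :> R.
Proof.
rewrite /hk -(Ex_posN R n (fun y => (y == x)%:R)); apply: Ex_ext => s _.
by rewrite eqr_oppLR.
Qed.

(** Chapman-Kolmogorov, with the symmetry of the walk used to write x + pos s
    instead of x - pos s. *)
Lemma hk_add (R : realFieldType) m n x :
  Ex n (fun s => hk m (x + pos s)) = hk (n + m) x :> R.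
Proof.
rewrite /hk Ex_cat -[LHS]Ex_flip; apply: Ex_ext => s _; apply: Ex_ext => t _.
by rewrite pos_cat pos_flip eq_sym subr_eq eq_sym addrC.
Qed.

Lemma hkS (R : realFieldType) n x :
  hk n.+1 x = 8%:R^-1 * \sum_(e : step) hk n (x + step_vec e) :> R.
Proof.
rewrite -add1n -hk_add /=; congr (_ * _); apply: eq_bigr => e _.
by rewrite pos_cons pos_nil addr0.
Qed.

(** Both sides are sums over x of p_m(x) p_n(x) f(x). The point is that the
    factor that is bounded uniformly (p_n, with n large) can be traded for
    the one that serves as a law. *)
Lemma Ex_hk_swap (R : realFieldType) m n (f : 'rV[int]_4 -> R) :
  Ex n (fun s => hk m (pos s) * f (pos s)) = Ex m (fun s => hk n (pos s) * f (pos s)).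
Proof.
under Ex_ext => s _ do rewrite -ExZr.
rewrite Ex_swap; apply: Ex_ext => t _.
by rewrite -ExZr; apply: Ex_ext => s _; rewrite eq_sym; case: eqP => [->|]; rewrite ?mul0r.
Qed.

Lemma Ex_mem (R : realFieldType) n (B : seq 'rV[int]_4) (f : 'rV[int]_4 -> R) :
  uniq B ->
  Ex n (fun s => (pos s \in B)%:R * f (pos s)) = \sum_(z <- B) hk n z * f z.
Proof.
move=> uB; under [RHS]eq_bigr => z _ do rewrite -ExZr.
rewrite -Ex_sum; apply: Ex_ext => s _.
elim: B uB => [|z B IH] /=; first by rewrite big_nil mul0r.
case/andP=> zB /IH {}IH; rewrite big_cons -IH inE.
case: eqP => [->|_]; last by rewrite mul0r add0r.
by rewrite (negbTE zB) mul0r addr0.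
Qed.

(** * Positive definiteness of the even transition probabilities *)

Definition hk_form {R : realFieldType} (n : nat) (r : seq (R * 'rV[int]_4)) : R :=
  \sum_(a <- r) \sum_(b <- r) a.1 * b.1 * hk n (a.2 - b.2).

(** At time 0 the form is the sum over the points z of the squared total
    weight carried by z. *)
Lemma hk_form0_ge0 (R : realFieldType) (r : seq (R * 'rV[int]_4)) : 0 <= hk_form 0 r.
Proof.
pose U := undup (map snd r).
suff -> : hk_form 0 r = \sum_(z <- U) (\sum_(a <- r) a.1 * (a.2 == z)%:R) ^+ 2.
  by apply: sumr_ge0 => z _; rewrite sqr_ge0.
transitivity (\sum_(z <- U) \sum_(a <- r) \sum_(b <- r)
    a.1 * b.1 * ((a.2 == z)%:R * (b.2 == z)%:R) : R); last first.
  apply: eq_bigr => z _; rewrite expr2 big_distrl /=; apply: eq_bigr => a _.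
  by rewrite big_distrr /=; apply: eq_bigr => b _; rewrite mulrACA.
rewrite exchange_big /=; apply: eq_big_seq => a ar.
rewrite exchange_big /=; apply: eq_bigr => b _.
rewrite -mulr_sumr hk0 subr_eq0; congr (_ * _).
rewrite (bigD1_seq a.2) ?undup_uniq //=; last by rewrite mem_undup map_f.
rewrite eqxx mul1r eq_sym big1 ?addr0 // => z.
by rewrite eq_sym => /negbTE ->; rewrite mul0r.
Qed.

(** Nonnegativity propagates in time: p_(s+2) averages p_s over pairs of
    steps, so the form of a list at time s+2 is the form at time s of the
    list obtained by replacing each point with its neighbours. *)
Lemma hk_form_ge0 (R : realFieldType) n (r : seq (R * 'rV[int]_4)) : 0 <= hk_form n.*2 r.
Proof.
elim: n r => [|n IH] r; first exact: hk_form0_ge0.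
pose r' := [seq (a.1, a.2 + step_vec e) | a <- r, e <- enum {: step}].
suff -> : hk_form n.+1.*2 r = (8%:R^-1) ^+ 2 * hk_form n.*2 r'.
  by rewrite mulr_ge0 ?sqr_ge0.
rewrite /hk_form big_allpairs_dep /= mulr_sumr; apply: eq_bigr => a _.
under [in RHS]eq_bigr => e _ do rewrite big_allpairs_dep /=.
rewrite exchange_big /= mulr_sumr; apply: eq_bigr => b _.
rewrite doubleS hkS expr2 -!mulrA !mulr_sumr big_enum /=.
apply: eq_bigr => e _; rewrite big_enum /= hkS !mulr_sumr.
rewrite (reindex_inj (inv_inj flipK)) /=.
apply: eq_bigr => e' _; rewrite step_vec_flip /=.
have -> : a.2 - b.2 + step_vec e - step_vec e' = a.2 + step_vec e - (b.2 + step_vec e').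
  by rewrite opprD addrACA addrA.
by ring.
Qed.

(** Positive definiteness applied to a unit mass at x minus a unit mass at 0. *)
Lemma hk_even_max (R : realFieldType) n x : hk n.*2 x <= hk n.*2 0 :> R.
Proof.
have := hk_form_ge0 R n [:: (1, x); (-1, 0)].
rewrite /hk_form !big_cons !big_nil /= !subrr subr0 sub0r hkN.
set a := hk _ _; set b := hk _ _ => H; lra.
Qed.

Definition hk_cross {R : realFieldType} (n : nat) (r t : seq (R * 'rV[int]_4)) : R :=
  \sum_(a <- r) \sum_(b <- t) a.1 * b.1 * hk n (a.2 - b.2).

(** The form of the signed list c r - t is nonnegative; expanding it bounds
    the cross term. This is Cauchy-Schwarz with a free parameter, which
    avoids square roots. *)
Lemma hk_cross_le (R : realFieldType) n (r t : seq (R * 'rV[int]_4)) (c : R) :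
  0 < c ->
  hk_cross n.*2 r t <= (c * hk_form n.*2 r + c^-1 * hk_form n.*2 t) / 2.
Proof.
move=> c0.
have := hk_form_ge0 R n ([seq (c * a.1, a.2) | a <- r] ++ [seq (- b.1, b.2) | b <- t]).
have -> : hk_form n.*2 ([seq (c * a.1, a.2) | a <- r] ++ [seq (- b.1, b.2) | b <- t])
   = c ^+ 2 * hk_form n.*2 r - c * (2 * hk_cross n.*2 r t) + hk_form n.*2 t.
  rewrite /hk_form big_cat !big_map /=.
  under eq_bigr => a _ do rewrite big_cat !big_map /=.
  rewrite big_split /=.
  under [X in _ + X]eq_bigr => a _ do rewrite big_cat !big_map /=.
  rewrite [X in _ + X]big_split /=.
  have -> : \sum_(i <- r) \sum_(i0 <- r) c * i.1 * (c * i0.1) * hk n.*2 (i.2 - i0.2)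
     = c ^+ 2 * \sum_(a <- r) \sum_(b <- r) a.1 * b.1 * hk n.*2 (a.2 - b.2).
    rewrite mulr_sumr; apply: eq_bigr => a _; rewrite mulr_sumr; apply: eq_bigr => b _; ring.
  have -> : \sum_(i <- r) \sum_(i0 <- t) c * i.1 * - i0.1 * hk n.*2 (i.2 - i0.2)
     = - c * hk_cross n.*2 r t.
    rewrite mulr_sumr; apply: eq_bigr => a _; rewrite mulr_sumr; apply: eq_bigr => b _; ring.
  have -> : \sum_(i <- t) \sum_(i0 <- r) - i.1 * (c * i0.1) * hk n.*2 (i.2 - i0.2)
     = - c * hk_cross n.*2 r t.
    rewrite exchange_big mulr_sumr; apply: eq_bigr => a _; rewrite mulr_sumr.
    by apply: eq_bigr => b _; rewrite -hkN opprB; ring.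
  have -> : \sum_(i <- t) \sum_(i0 <- t) - i.1 * - i0.1 * hk n.*2 (i.2 - i0.2)
     = \sum_(a <- t) \sum_(b <- t) a.1 * b.1 * hk n.*2 (a.2 - b.2).
    by apply: eq_bigr => a _; apply: eq_bigr => b _; rewrite mulrNN.
  ring.
set A := hk_form _ r; set B := hk_form _ t; set X := hk_cross _ _ _ => H.
have -> : (c * A + c^-1 * B) / 2 = X + c^-1 * (c ^+ 2 * A - c * (2 * X) + B) / 2.
  by field; rewrite gt_eqF.
by rewrite lerDl divr_ge0 // mulr_ge0 // invr_ge0 ltW.
Qed.

(** * Truncated Green functions *)

(** Truncating at time M keeps every sum finite. The upper bounds below are
    uniform in M, and the truncation error is a tail of order 1/M. *)
Definition green {R : realFieldType} (M : nat) (x : 'rV[int]_4) : R :=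
  \sum_(s < M) hk s x.

Lemma greenN (R : realFieldType) M x : green M (- x) = green M x :> R.
Proof. by apply: eq_bigr => s _; rewrite hkN. Qed.

Lemma green_ge0 (R : realFieldType) M x : 0 <= green M x :> R.
Proof. by apply: sumr_ge0 => s _; apply: hk_ge0. Qed.

Lemma Ex_green (R : realFieldType) M n x :
  Ex n (fun s => green M (x + pos s)) = \sum_(i < M) hk (n + i) x :> R.
Proof. by rewrite Ex_sum; apply: eq_bigr => i _; rewrite hk_add. Qed.

(** * Upper bound of the transition probabilities *)

Lemma bin_incr_half n j h : (j <= h)%N -> (h.*2 <= n)%N -> ('C(n, j) <= 'C(n, h))%N.
Proof.
move=> jh; rewrite -(subnKC jh); elim: (h - j)%N => [|d IH]; first by rewrite addn0.
rewrite addnS => dn; apply: leq_trans (IH _) _; first lia.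
rewrite -(leq_pmul2l (ltn0Sn (j + d))) mul_bin_left leq_mul2r; apply/orP; right; lia.
Qed.

Lemma bin_max_half n j : ('C(n, j) <= 'C(n, n./2))%N.
Proof.
case: (leqP j n) => jn; last by rewrite bin_small.
case: (leqP j n./2) => jh; first by apply: bin_incr_half => //; lia.
rewrite -bin_sub //; apply: bin_incr_half; lia.
Qed.

(** By induction, from the ratio of consecutive central binomial
    coefficients. *)
Lemma bin_central_sqr m : ('C(m.*2, m) ^ 2 * m.+1 <= 16 ^ m)%N.
Proof.
elim: m => [//|m IH].
have H : (m.+1 * 'C(m.+1.*2, m.+1) = (m.*2.+1).*2 * 'C(m.*2, m))%N.
  have e1 := mul_bin_diag m.+1.*2 m; have e2 := mul_bin_down m.*2.+1 m.
  rewrite doubleS /= in e1 e2 *.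
  nia.
rewrite -(leq_pmul2l (ltn0Sn m)) -(leq_pmul2l (ltn0Sn m)) [(16 ^ _)%N]expnS.
have -> : (m.+1 * (m.+1 * ('C(m.+1.*2, m.+1) ^ 2 * m.+2)) =
   (m.+1 * 'C(m.+1.*2, m.+1)) ^ 2 * m.+2)%N by rewrite -!mulnn; nia.
rewrite H.
set C := 'C(_, _) in IH *; set Q := (16 ^ m)%N in IH *.
rewrite [leqRHS](_ : _ = 16 * m.+1 * m.+1 * Q)%N; last by ring.
apply: leq_trans (leq_mul (leqnn _) IH).
have -> : ((m.*2.+1.*2 * C) ^ 2 * m.+2 = C ^ 2 * ((m.*2.+1.*2) ^ 2 * m.+2))%N by ring.
have -> : (16 * m.+1 * m.+1 * (C ^ 2 * m.+1) = C ^ 2 * (16 * m.+1 * m.+1 * m.+1))%N by ring.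
by rewrite leq_mul2l; apply/orP; right; rewrite -!mulnn; nia.
Qed.

Lemma bin_sqr_le n j : ('C(n, j) ^ 2 * n.+2 <= 2 * 4 ^ n)%N.
Proof.
have H : ('C(n, j) ^ 2 <= 'C(n, n./2) ^ 2)%N by rewrite leq_sqr bin_max_half.
apply: leq_trans (leq_mul H (leqnn _)) _.
have -> : n = (odd n + n./2.*2)%N by rewrite odd_double_half.
set m := n./2; case: (odd n) => /=; rewrite ?add0n ?add1n.
  rewrite [X in 'C(_, X)](_ : _ = m); last lia.
have := bin_central_sqr m.+1.
have -> : ('C(m.+1.*2, m.+1) = 2 * 'C(m.*2.+1, m))%N.
  rewrite doubleS binS -(@bin_sub m.*2.+1 m.+1); last lia.
  have e : (m.*2.+1 - m.+1 = m)%N by lia.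
  by rewrite e mul2n addnn.
rewrite -[m.*2]mul2n [(4 ^ (_).+1)%N]expnS expnM [(16 ^ m.+1)%N]expnS.
  rewrite (_ : 4 ^ 2 = 16)%N //; nia.
rewrite doubleK; have := bin_central_sqr m.
by rewrite -[in (4 ^ _)%N]mul2n expnM (_ : 4 ^ 2 = 16)%N //; nia.
Qed.

(** Transition probabilities of the simple random walk on the integers. *)
Fixpoint srw1 {R : realFieldType} (k : nat) (y : int) : R :=
  if k is k'.+1 then (srw1 k' (y - 1) + srw1 k' (y + 1)) / 2 else (y == 0)%:R.

Lemma srw1_bin (R : realFieldType) k y :
  (forall j : nat, y = j%:Z *+ 2 - k%:Z -> srw1 k y = 'C(k, j)%:R / 2 ^+ k :> R) /\
  ((forall j : nat, y <> j%:Z *+ 2 - k%:Z) -> srw1 k y = 0 :> R).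
Proof.
elim: k y => [|k IH] y /=.
  split=> [j ->|H]; last by case: eqP (H 0%N) => // ->.
  rewrite bin0n expr0 divr1 subr0; congr (_%:R); apply/eqP/eqP; lia.
have [IH1 IH1'] := IH (y - 1); have [IH2 IH2'] := IH (y + 1); split.
  move=> [|j] yE.
    rewrite IH1' ?(IH2 0%N); [|lia|move=> j; lia].
    by rewrite !bin0 add0r exprS invfM mulrA; ring.
  rewrite (IH1 j) ?(IH2 j.+1); try lia.
  rewrite binS natrD exprS invfM; ring.
move=> H; rewrite IH1' ?IH2' ?addr0 ?mul0r // => j yE.
  by apply: (H j); lia.
by apply: (H j.+1); lia.
Qed.

Lemma srw1_sqr_le (R : realFieldType) k y : srw1 k y ^+ 2 <= 2 / (k%:R + 2) :> R.
Proof.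
have [H1 H2] := srw1_bin R k y.
have k2 : 0 < k%:R + 2 :> R by rewrite ltr_wpDl ?ler0n.
have [[j yE]|H] : (exists j : nat, y = j%:Z *+ 2 - k%:Z) \/
    (forall j : nat, y <> j%:Z *+ 2 - k%:Z).
  case: (boolP [exists j : 'I_(`|y|%N + k).+1, y == j%:Z *+ 2 - k%:Z]).
    by case/existsP => j /eqP ->; left; exists j.
  move=> /existsPn H; right => j yE.
  have jb : (j < (`|y|%N + k).+1)%N by lia.
  by have := H (Ordinal jb); rewrite /= -yE eqxx.
  rewrite (H1 j yE) ler_pdivlMr // expr_div_n -exprM mulnC exprM mulrAC.
  rewrite ler_pdivrMr ?exprn_gt0 // -natrX -natrX -(natrD _ k 2) -natrM -natrX -natrM ler_nat.
  by rewrite addn2; exact: bin_sqr_le.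
by rewrite H2 // expr0n divr_ge0 // ltW.
Qed.

(** If the four-dimensional walk has made k_i steps in direction i, the
    coordinates are independent one-dimensional walks; this is the joint
    probability that they sit at x. *)
Definition srw1_prod {R : realFieldType} (k : 'I_4 -> nat) (x : 'rV[int]_4) : R :=
  \prod_(i < 4) srw1 (k i) (x 0 i).

Definition incr (k : 'I_4 -> nat) (i : 'I_4) : 'I_4 -> nat := fun j => (k j + (j == i))%N.

(** A step of the walk advances one uniformly chosen coordinate by one step
    of the one-dimensional walk. *)
Lemma avg_srw1_prod (R : realFieldType) k x :
  8%:R^-1 * (\sum_(e : step) srw1_prod k (x + step_vec e))
  = 4%:R^-1 * \sum_(i < 4) srw1_prod (incr k i) x :> R.
Proof.
rewrite -(pair_bigA _ (fun i b => srw1_prod k (x + step_vec (i, b)))) /= !mulr_sumr.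
apply: eq_bigr => i _; rewrite big_bool /step_vec /= /srw1_prod.
rewrite (bigD1 i) //= [in X in _ + X](bigD1 i) //= [in RHS](bigD1 i) //=.
have E b : \prod_(j < 4 | j != i) srw1 (k j) ((x + (if b then delta_mx 0 i else - delta_mx 0 i)) 0 j)
   = \prod_(j < 4 | j != i) srw1 (incr k i j) (x 0 j) :> R.
  apply: eq_bigr => j ji; rewrite /incr (negbTE ji) addn0; congr (srw1 _ _).
  by case: b; rewrite !mxE eqxx (negbTE ji) ?subr0 ?addr0.
rewrite (E true) (E false) !mxE !eqxx /incr eqxx addn1 /=.
by field.
Qed.

(** By the arithmetic-geometric inequality the product of four factors of
    order k_i^(-1/2) is at most the mean of their fourth powers, each of
    order k_i^(-2). The four coordinates are then decoupled: only the law of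
    a single k_i matters. *)
Lemma srw1_prod_le (R : realFieldType) k x :
  srw1_prod k x <= \sum_(i < 4) ((k i)%:R + 2) ^- 2 :> R.
Proof.
have H (i : 'I_4) : srw1 (k i) (x 0 i) ^+ 4 / 4%:R <= ((k i)%:R + 2) ^- 2 :> R.
  have h := srw1_sqr_le R (k i) (x 0 i).
  rewrite (exprM _ 2 2) ler_pdivrMr //.
  have -> : ((k i)%:R + 2) ^- 2 * 4%:R = (2 / ((k i)%:R + 2)) ^+ 2 :> R.
    by rewrite expr_div_n mulrC; congr (_ / _); ring.
  by rewrite ler_sqr ?nnegrE ?sqr_ge0 // divr_ge0 // addr_ge0.
apply: le_trans (ler_sum _ (fun i _ => H i)).
rewrite /srw1_prod !big_ord_recl !big_ord0 mulr1 addr0.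
set a := srw1 _ _; set b := srw1 _ _; set c := srw1 _ _; set d := srw1 _ _.
have h1 := sqr_ge0 (a * b - c * d); have h2 := sqr_ge0 (a ^+ 2 - b ^+ 2).
have h3 := sqr_ge0 (c ^+ 2 - d ^+ 2).
nra.
Qed.

(** The expectation of (k + const)^(-2) decreases as k makes one step with
    probability 1/4, at least as fast as if k moved deterministically at
    speed 1/8: the speed is half the true drift, which leaves room for the
    convexity of z^(-2). *)
Lemma potential_step (R : realFieldType) (z : R) : 2 <= z ->
  4%:R^-1 * ((z + 1) ^- 2 + 3 * z ^- 2) <= (z + 8%:R^-1) ^- 2.
Proof.
move=> z2.
have z0 : 0 < z by lra.
(* The numerator of the difference of the two sides. *)
have H : 0 <= z ^+ 3 - z ^+ 2 * (9%:R / 16%:R) - z * (27%:R / 32%:R) - 3%:R / 64%:R.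
  have : 0 <= (z - 2) * (z ^+ 2) by rewrite mulr_ge0 ?sqr_ge0 ?subr_ge0.
  have : 0 <= (z - 2) * z by rewrite mulr_ge0 ?subr_ge0 // ltW.
  nra.
rewrite -subr_ge0.
have -> : (z + 8%:R^-1) ^- 2 - 4%:R^-1 * ((z + 1) ^- 2 + 3 * z ^- 2) =
  (z ^+ 3 - z ^+ 2 * (9%:R / 16%:R) - z * (27%:R / 32%:R) - 3%:R / 64%:R)
   / (4%:R * (z + 8%:R^-1) ^+ 2 * (z + 1) ^+ 2 * z ^+ 2).
  field; rewrite ?gt_eqF //=; lra.
apply: divr_ge0 => //; apply: mulr_ge0; last exact: sqr_ge0.
by apply: mulr_ge0; [apply: mulr_ge0 => //|]; exact: sqr_ge0.
Qed.

(** The right-hand side dominates at time 0 by [srw1_prod_le], and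
    [potential_step] shows that it is a supersolution of the recursion of the
    step counts. *)
Lemma Ex_srw1_prod_le (R : realFieldType) n k x :
  Ex n (fun s => srw1_prod k (x + pos s))
  <= \sum_(i < 4) ((k i)%:R + 2 + n%:R / 8%:R) ^- 2 :> R.
Proof.
elim: n k x => [|n IH] k x.
  rewrite /= pos_nil addr0; apply: le_trans (srw1_prod_le _ _ _) _.
  by under [leRHS]eq_bigr => i _ do rewrite mul0r addr0.
rewrite -addn1 Ex_cat /=.
have -> : Ex n (fun s => 8%:R^-1 * \sum_(e : step) srw1_prod k (x + pos (s ++ [:: e])))
  = Ex n (fun s => 4%:R^-1 * \sum_(i < 4) srw1_prod (incr k i) (x + pos s)) :> R.
  apply: Ex_ext => s _; rewrite -avg_srw1_prod; congr (_ * _).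
  by apply: eq_bigr => e _; rewrite pos_cat pos_cons pos_nil addr0 addrA.
rewrite ExZ Ex_sum.
apply: le_trans (ler_wpM2l _ (ler_sum _ (fun i _ => IH (incr k i) x))) _.
  by rewrite invr_ge0.
rewrite exchange_big mulr_sumr; apply: ler_sum => i _ /=.
pose z : R := (k i)%:R + 2 + n%:R / 8%:R.
have -> : (k i)%:R + 2 + (n + 1)%:R / 8%:R = z + 8%:R^-1 :> R.
  by rewrite natrD /z; field.
have z2 : 2 <= z by rewrite /z addrAC lerDr addr_ge0 ?divr_ge0.
apply: le_trans _ (potential_step _ _ z2); rewrite ler_wpM2l ?invr_ge0 //.
rewrite (bigD1 i) //= /incr eqxx.
have -> : (k i + true)%:R + 2 + n%:R / 8%:R = z + 1 :> R by rewrite /= natrD /z; ring.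
rewrite lerD2l (eq_bigr (fun=> z ^- 2)); last first.
  by move=> j ji; rewrite eq_sym (negbTE ji) addn0.
by rewrite big_const iter_addr_0 -[_ *+ _]mulr_natl cardC1 card_ord.
Qed.

Definition heat_cst {R : realFieldType} : R := 256%:R.

Lemma heat_cst_gt0 (R : realFieldType) : 0 < heat_cst :> R. Proof. exact: ltr0Sn. Qed.

Lemma heat_cst_ge0 (R : realFieldType) : 0 <= heat_cst :> R. Proof. exact: ltW (heat_cst_gt0 R). Qed.

(** The local limit upper bound p_n(x) = O(n^(-2)) in dimension four:
    [Ex_srw1_prod_le] with all step counts equal to 0 at the start. *)
Lemma hk_le (R : realFieldType) n x : hk n x <= heat_cst / (n%:R + 1) ^+ 2 :> R.
Proof.
rewrite /heat_cst.
have := Ex_srw1_prod_le R n (fun=> 0%N) (- x).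
have -> : Ex n (fun s => srw1_prod (fun=> 0%N) (- x + pos s)) = hk n x :> R.
  apply: Ex_ext => s _; rewrite /srw1_prod /=.
  case: eqP => [->|nx]; first by rewrite big1 // => i _; rewrite addNr mxE.
  have [i Hi] : exists i, pos s 0 i != x 0 i.
    apply/existsP; rewrite -negb_forall; apply/negP => /forallP H; apply: nx.
    by apply/rowP => i; apply/eqP.
  by rewrite (bigD1 i) //= !mxE addrC subr_eq0 (negbTE Hi) mul0r.
move/le_trans; apply.
rewrite big_const iter_addr_0 card_ord -[_ *+ _]mulr_natl add0r.
have n0 : 0 <= n%:R :> R by rewrite ler0n.
have -> : 2 + n%:R / 8%:R = (n%:R + 16%:R) / 8%:R :> R by field.
rewrite expr_div_n invf_div mulrA (_ : 4 * 8 ^+ 2 = 256%:R); last by ring.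
rewrite ler_wpM2l // lef_pV2 ?posrE ?exprn_gt0 ?ltr_wpDl //.
by rewrite ler_sqr ?nnegrE ?addr_ge0 // lerD2l; lra.
Qed.

Global Opaque heat_cst.

(** * Lower bound of the return probabilities *)

Definition sq_norm {R : realFieldType} (x : 'rV[int]_4) : R := \sum_(i < 4) (x 0 i)%:~R ^+ 2.

Lemma sq_norm_ge0 (R : realFieldType) x : 0 <= sq_norm x :> R.
Proof. by apply: sumr_ge0 => i _; rewrite sqr_ge0. Qed.

(** The squared norm minus time is a martingale. *)
Lemma avg_sq_norm (R : realFieldType) x :
  8%:R^-1 * (\sum_(e : step) sq_norm (x + step_vec e)) = sq_norm x + 1 :> R.
Proof.
have E i : sq_norm (x + delta_mx 0 i) + sq_norm (x - delta_mx 0 i) = (sq_norm x + 1) * 2 :> R.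
  rewrite /sq_norm -big_split /= (bigD1 i) //= [in RHS](bigD1 i) //= !mxE !eqxx.
  rewrite (eq_bigr (fun j => 2 * (x 0 j)%:~R ^+ 2)); last first.
    by move=> j ji; rewrite !mxE eqxx (negbTE ji) /=; ring.
  rewrite -mulr_sumr /= !rmorphD /= rmorphN /= ; ring.
rewrite -(pair_bigA _ (fun i b => sq_norm (x + step_vec (i, b)))) /=.
rewrite (eq_bigr (fun=> (sq_norm x + 1) * 2)); last first.
  by move=> i _; rewrite big_bool; exact: E.
by rewrite big_const iter_addr_0 card_ord -[_ *+ 4]mulr_natl; field.
Qed.

Lemma Ex_sq_norm (R : realFieldType) n x :
  Ex n (fun s => sq_norm (x + pos s)) = sq_norm x + n%:R :> R.
Proof.
elim: n x => [|n IH] x; first by rewrite /= pos_nil !addr0.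
rewrite /= (eq_bigr (fun e => sq_norm (x + step_vec e) + n%:R)); last first.
  by move=> e _; rewrite -IH; apply: Ex_ext => s _; rewrite pos_cons addrA.
rewrite big_split /= mulrDr avg_sq_norm big_const iter_addr_0 card_step -[n.+1]addn1 natrD.
by rewrite -[n%:R *+ 8]mulr_natl mulrA mulVf ?mul1r ?pnatr_eq0 // -addrA [1 + _]addrC.
Qed.

Lemma nat_sqrtP n : exists r, (r ^ 2 <= n < r.+1 ^ 2)%N.
Proof.
elim: n => [|n [r /andP[h1 h2]]]; first by exists 0%N.
case: (ltnP n.+1 (r.+1 ^ 2)) => h; first by exists r; rewrite h leqW.
by exists r.+1; rewrite h /=; rewrite -!mulnn in h h2 *; lia.
Qed.

Definition box_point (r : nat) (f : {ffun 'I_4 -> 'I_(r.*2.+1)}) : 'rV[int]_4 :=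
  \row_i ((f i : nat)%:Z - r%:Z).

Definition box (r : nat) : seq 'rV[int]_4 :=
  [seq box_point r f | f <- enum {: {ffun 'I_4 -> 'I_(r.*2.+1)}}].

Lemma box_uniq r : uniq (box r).
Proof.
rewrite map_inj_uniq ?enum_uniq // => f g fg; apply/ffunP => i; apply/val_inj.
have := congr1 (fun x : 'rV_4 => x 0 i) fg; rewrite !mxE => /addIr [].
exact.
Qed.

Lemma size_box r : size (box r) = (r.*2.+1 ^ 4)%N.
Proof. by rewrite size_map -cardE card_ffun !card_ord. Qed.

Lemma mem_box r (x : 'rV[int]_4) : (forall i, `|x 0 i| <= r%:Z) -> x \in box r.
Proof.
move=> H.
pose y (i : 'I_4) := absz (x 0 i + r%:Z).
have Hb i : (y i < r.*2.+1)%N by rewrite /y; have := H i; lia.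
apply/mapP; exists [ffun i => Ordinal (Hb i)]; first by rewrite mem_enum.
by apply/rowP => i; rewrite mxE ffunE /= /y; have := H i; lia.
Qed.

Lemma notin_box (R : realFieldType) r (x : 'rV[int]_4) :
  (x \notin box r)%:R <= sq_norm x / (r%:R + 1) ^+ 2 :> R.
Proof.
have r1 : 0 < (r%:R + 1) ^+ 2 :> R by rewrite exprn_gt0 // ltr_wpDl.
case: (boolP (x \in box r)) => [_|xb] /=.
  by rewrite divr_ge0 ?sq_norm_ge0 // ltW.
rewrite ler_pdivlMr // mul1r.
have [i Hi] : exists i, ~~ (`|x 0 i| <= r%:Z).
  apply/existsP; rewrite -negb_forall; apply: contra xb => /forallP; exact: mem_box.
rewrite /sq_norm (bigD1 i) //= ler_wpDr ?sumr_ge0 // => [j _|]; first exact: sqr_ge0.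
rewrite -[leRHS]real_normK ?num_real // ler_sqr ?nnegrE ?normr_ge0 ?addr_ge0 //.
rewrite -intr_norm -[r%:R]/((r%:Z)%:~R) -[1]/(1%:~R) -intrD ler_int.
move: Hi; rewrite -ltNge; lia.
Qed.

Definition return_cst {R : realFieldType} : R := 1296%:R.

Lemma return_cst_gt0 (R : realFieldType) : 0 < return_cst :> R. Proof. exact: ltr0Sn. Qed.

(** Since p_(2s)(0) is the sum of the squares of p_s, and by Chebyshev half
    of the mass of p_s lies in a box of about s^2 points, Cauchy-Schwarz
    gives a lower bound of order s^(-2). *)
Lemma hk_lower (R : realFieldType) s : (0 < s)%N ->
  (return_cst * s%:R ^+ 2)^-1 <= hk s.*2 0 :> R.
Proof.
rewrite /return_cst.
move=> s0; have [r /andP[r1 r2]] := nat_sqrtP s.*2.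
have r0 : (0 < r)%N by rewrite lt0n; apply/eqP => re; move: r2; rewrite re; lia.
pose P : R := \sum_(z <- box r) hk s z.
have PE : P = Ex s (fun t => (pos t \in box r)%:R).
  rewrite /P; under eq_bigr do rewrite -[hk _ _]mulr1.
  by rewrite -Ex_mem ?box_uniq //; apply: Ex_ext => t _; rewrite mulr1.
have P2 : 2^-1 <= P.
  have : Ex s (fun t => (pos t \notin box r)%:R) <= 2^-1 :> R.
    apply: le_trans (_ : Ex s (fun t => sq_norm (0 + pos t) / (r%:R + 1) ^+ 2) <= _).
      by apply: Ex_le => t _; rewrite add0r notin_box.
    rewrite ExZr Ex_sq_norm /sq_norm big1 ?add0r; last by move=> i _; rewrite mxE expr0n.
    rewrite ler_pdivrMr ?exprn_gt0 ?ltr_wpDl // ler_pdivlMl // natr1 -natrX -natrM ler_nat.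
    by rewrite mul2n ltnW.
  have -> : Ex s (fun t => (pos t \notin box r)%:R) = 1 - P :> R.
    rewrite PE -[X in _ = X - _](Ex_cst R s 1) -ExB; apply: Ex_ext => t _.
    by case: (_ \in _); rewrite /= ?subrr ?subr0.
  by lra.
have N0 : 0 < (size (box r))%:R :> R by rewrite size_box ltr0n expn_gt0.
pose N : R := (size (box r))%:R.
have H : (4%:R * N)^-1 <= hk s.*2 0 :> R.
  apply: le_trans (_ : \sum_(z <- box r) hk s z * hk s z <= _); last first.
    rewrite -Ex_mem ?box_uniq // -addnn -hk_add; apply: Ex_le => t _.
    by rewrite add0r; case: (_ \in _); rewrite ?mul1r ?mul0r ?hk_ge0.
  (* p^2 is above its tangent line at 1/(2N). *)
  apply: le_trans (_ : \sum_(z <- box r) (N^-1 * hk s z - (4%:R * N ^+ 2)^-1) <= _).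
    rewrite big_split /= -mulr_sumr -/P sumrN big_const_seq count_predT iter_addr_0.
    rewrite -[_ *+ size _]mulr_natr -/N.
    have -> : (4%:R * N ^+ 2)^-1 * N = (4%:R * N)^-1 by field; rewrite gt_eqF.
    have : N^-1 * 2^-1 <= N^-1 * P by rewrite ler_wpM2l // invr_ge0 ltW.
    by rewrite !invfM; lra.
  apply: ler_sum => z _; rewrite -subr_ge0.
  have -> : hk s z * hk s z - (N^-1 * hk s z - (4 * N ^+ 2)^-1)
     = (hk s z - (2 * N)^-1) ^+ 2 by field; rewrite gt_eqF.
  exact: sqr_ge0.
apply: le_trans H; rewrite lef_pV2 ?posrE ?mulr_gt0 ?exprn_gt0 ?ltr0n ?size_box ?expn_gt0 //.
rewrite /N size_box -!natrX -!natrM ler_nat.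
have h : (r.*2.+1 ^ 4 <= (9 * r ^ 2) ^ 2)%N.
  rewrite (expnM _ 2 2) leq_sqr -mulnn; rewrite -mulnn; nia.
apply: leq_trans (_ : 4 * (9 * r ^ 2) ^ 2 <= _)%N; first by rewrite leq_mul2l h orbT.
apply: leq_trans (_ : 4 * (9 * s.*2) ^ 2 <= _)%N; last by rewrite -!mulnn; nia.
by rewrite leq_mul2l leq_sqr leq_mul2l r1 !orbT.
Qed.

Global Opaque return_cst.

(** * Tails of the Green function *)

Lemma twice_heat_cst_ge0 (R : realFieldType) : 0 <= 2 * heat_cst :> R.
Proof. by rewrite mulr_ge0 ?heat_cst_ge0. Qed.

Lemma tail_ge0 (R : realFieldType) M : 0 <= (2 * heat_cst) / (M%:R + 1) :> R.
Proof. by rewrite divr_ge0 ?twice_heat_cst_ge0 // addr_ge0. Qed.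

(** Summing the bound O(s^(-2)) from time M on, through a telescoping
    majorant. *)
Lemma hk_tail (R : realFieldType) M k x :
  \sum_(i < k) hk (M + i) x <= (2 * heat_cst) / (M%:R + 1) :> R.
Proof.
have M0 j : 0 < (M + j)%:R + 1 :> R by rewrite ltr_wpDl.
suff H : \sum_(i < k) hk (M + i) x <= (2 * heat_cst) / (M%:R + 1) - (2 * heat_cst) / ((M + k)%:R + 1) :> R.
  by apply: le_trans H _; rewrite gerBl divr_ge0 ?twice_heat_cst_ge0 // ltW.
elim: k => [|k IH]; first by rewrite big_ord0 addn0 subrr.
rewrite big_ord_recr /=; apply: le_trans (lerD IH (hk_le _ _ _)) _.
rewrite addnS -[(M + k).+1%:R]natr1; have := M0 k; set z := (M + k)%:R + 1 => z0.
suff : heat_cst / z ^+ 2 <= (2 * heat_cst) / z - (2 * heat_cst) / (z + 1).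
  by set a := _ / z ^+ 2; set b := _ / (z + 1); set c := _ / z; set d := _ / _; lra.
have z1 : 1 <= z by rewrite /z lerDr.
rewrite -subr_ge0.
have -> : (2 * heat_cst) / z - (2 * heat_cst) / (z + 1) - heat_cst / z ^+ 2 = heat_cst * (z - 1) / (z ^+ 2 * (z + 1)).
  by field; rewrite ?gt_eqF //; lra.
by rewrite divr_ge0 ?mulr_ge0 ?heat_cst_ge0 ?subr_ge0 ?sqr_ge0 // ?addr_ge0 // ltW.
Qed.

Lemma hk_tail_mul (R : realFieldType) M k x :
  \sum_(i < k) hk (M + i.*2) x <= (2 * heat_cst) / (M%:R + 1) :> R.
Proof.
apply: le_trans (hk_tail R M k.*2 x).
elim: k => [|k IH]; first by rewrite !big_ord0.
rewrite doubleS !big_ord_recr /= -addrA lerD // lerDl; exact: hk_ge0.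
Qed.

(** * Escape probabilities and last exit decomposition *)

Fixpoint avoid (A : seq 'rV[int]_4) (x : 'rV[int]_4) (s : seq step) : bool :=
  if s is e :: s' then (x + step_vec e \notin A) && avoid A (x + step_vec e) s' else true.

Definition esc_upto {R : realFieldType} (A : seq 'rV[int]_4) (n : nat) (x : 'rV[int]_4) : R :=
  Ex n (fun s => (avoid A x s)%:R).

Lemma esc_uptoS (R : realFieldType) A n x :
  esc_upto A n.+1 x
  = 8%:R^-1 * \sum_(e : step) (x + step_vec e \notin A)%:R * esc_upto A n (x + step_vec e) :> R.
Proof.
rewrite /esc_upto /=; congr (_ * _); apply: eq_bigr => e _; rewrite -ExZ.
by apply: Ex_ext => s _; rewrite -natrM mulnb.
Qed.

Lemma esc_upto_ge0 (R : realFieldType) A n x : 0 <= esc_upto A n x :> R.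
Proof. by apply: Ex_ge0 => s _; rewrite ler0n. Qed.

Lemma esc_upto_le1 (R : realFieldType) A n x : esc_upto A n x <= 1 :> R.
Proof. by rewrite -(Ex_cst R n 1); apply: Ex_le => s _; case: avoid. Qed.

Lemma esc_upto_decr (R : realFieldType) A n x : esc_upto A n.+1 x <= esc_upto A n x :> R.
Proof.
elim: n x => [|n IH] x; first by rewrite [leRHS]/esc_upto /=; exact: esc_upto_le1.
rewrite [leRHS]esc_uptoS esc_uptoS ler_wpM2l ?invr_ge0 //; apply: ler_sum => e _.
by rewrite ler_wpM2l.
Qed.

Lemma esc_upto_anti (R : realFieldType) A m n x : (m <= n)%N -> esc_upto A n x <= esc_upto A m x :> R.
Proof.
move=> mn; rewrite -(subnKC mn); elim: (n - m)%N => [|d IH]; first by rewrite addn0.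
by rewrite addnS; apply: le_trans (esc_upto_decr _ _ _ _) IH.
Qed.

Lemma esc_upto_sub (R : realFieldType) (A B : seq 'rV[int]_4) n x :
  {subset A <= B} -> esc_upto B n x <= esc_upto A n x :> R.
Proof.
move=> AB; apply: Ex_le => s _; rewrite ler_nat.
suff : avoid B x s -> avoid A x s by case: (avoid B x s) => // ->.
elim: s x => [//|e s IH] x /= /andP[xB /IH ->]; rewrite andbT.
by apply: contra xB; exact: AB.
Qed.

Lemma esc_upto_shift (R : realFieldType) (A : seq 'rV[int]_4) n z x :
  esc_upto [seq z + a | a <- A] n (z + x) = esc_upto A n x :> R.
Proof.
apply: Ex_ext => s _; congr (nat_of_bool _)%:R.
elim: s x => [//|e s IH] x /=; rewrite -addrA IH; congr (~~ _ && _).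
by rewrite mem_map //; apply: addrI.
Qed.

(** Decompose according to the last time t in [0, N] at which A is visited;
    the right-hand side is the probability that such a time exists. *)
Lemma last_exit (R : realFieldType) (A : seq 'rV[int]_4) N x :
  \sum_(t < N.+1) \sum_(y <- undup A) hk t (y - x) * esc_upto A (N - t) y
  = 1 - (x \notin A)%:R * esc_upto A N x :> R.
Proof.
have first z n : \sum_(y <- undup A) hk 0 (y - z) * esc_upto A n y = (z \in A)%:R * esc_upto A n z :> R.
  case: (boolP (z \in A)) => zA; last first.
    rewrite mul0r big1_seq // => y; rewrite mem_undup => /andP[_ yA].
    by rewrite hk0 subr_eq0; case: eqP => [yz|_]; [rewrite -yz yA in zA | rewrite mul0r].
  rewrite (bigD1_seq z) ?undup_uniq ?mem_undup //= hk0 subrr eqxx !mul1r big1 ?addr0 //.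
  by move=> y yz; rewrite hk0 subr_eq0 (negbTE yz) mul0r.
elim: N x => [|N IH] x.
  rewrite big_ord1 first /esc_upto /=; case: (_ \in _) => /=; ring.
rewrite big_ord_recl first.
have -> : \sum_(t < N.+1) \sum_(y <- undup A) hk (bump 0 t) (y - x) * esc_upto A (N.+1 - bump 0 t) y
  = 8%:R^-1 * \sum_(e : step) (1 - (x + step_vec e \notin A)%:R * esc_upto A N (x + step_vec e)) :> R.
  under [in RHS]eq_bigr => e _ do rewrite -IH.
  rewrite [in RHS]exchange_big mulr_sumr; apply: eq_bigr => t _.
  rewrite [in RHS]exchange_big mulr_sumr; apply: eq_bigr => y _ /=.
  rewrite /bump add1n subSS hkS -mulrA mulr_suml; congr (_ * _).
  rewrite [RHS](reindex_inj (inv_inj flipK)) /=; apply: eq_bigr => e _.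
  by rewrite step_vec_flip opprB addrCA [step_vec e + _]addrC.
rewrite sumrB mulrBr -esc_uptoS big_const iter_addr_0 card_step.
rewrite -[1 *+ 8]mulr_natl mulr1 mulVf ?pnatr_eq0 // subn0 /=.
case: (_ \in _) => /=; ring.
Qed.

Definition esc {R : realType} (A : seq 'rV[int]_4) (x : 'rV[int]_4) : R :=
  limn (fun n => esc_upto A n x : R).

Lemma esc_cvg (R : realType) A x : (fun n => esc_upto A n x : R) @ \oo --> (esc A x : R).
Proof.
apply: nonincreasing_is_cvgn; first by move=> m n; apply: esc_upto_anti.
by exists 0 => _ [n _ <-]; exact: esc_upto_ge0.
Qed.

Lemma esc_le_esc_upto (R : realType) A n x : esc A x <= esc_upto A n x :> R.
Proof.
apply: (nonincreasing_cvgn_ge (u_ := fun n => esc_upto A n x : R)).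
  by move=> i j; apply: esc_upto_anti.
by apply/cvg_ex; exists (esc A x); exact: esc_cvg.
Qed.

Lemma esc_le1 (R : realType) A x : esc A x <= 1 :> R.
Proof. exact: le_trans (esc_le_esc_upto _ _ 0 _) (esc_upto_le1 _ _ _ _). Qed.

Lemma esc_ge (R : realType) A x (c : R) : (forall n, c <= esc_upto A n x) -> c <= esc A x.
Proof.
move=> H; apply: limr_ge; last by apply: nearW => n; exact: H.
by apply/cvg_ex; exists (esc A x); exact: esc_cvg.
Qed.

Lemma esc_ge0 (R : realType) A x : 0 <= esc A x :> R.
Proof. by apply: esc_ge => n; exact: esc_upto_ge0. Qed.

Lemma esc_sub (R : realType) (A B : seq 'rV[int]_4) x :
  {subset A <= B} -> esc B x <= esc A x :> R.
Proof.
by move=> AB; apply: esc_ge => n; apply: le_trans (esc_le_esc_upto _ _ n _) (esc_upto_sub _ _ _ _ _ AB).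
Qed.

Lemma esc_eq_mem (R : realType) (A B : seq 'rV[int]_4) x :
  A =i B -> esc A x = esc B x :> R.
Proof. by move=> AB; apply/eqP; rewrite eq_le !esc_sub // => y; rewrite AB. Qed.

Lemma esc_shift (R : realType) (A : seq 'rV[int]_4) z x :
  esc [seq z + a | a <- A] (z + x) = esc A x :> R.
Proof. by rewrite /esc; congr (limn _); apply/funext => n; exact: esc_upto_shift. Qed.

(** By [last_exit] this potential is at most a hitting probability, since
    escaping forever is less likely than escaping up to a finite time. *)
Lemma potential_le1 (R : realType) (A : seq 'rV[int]_4) M x :
  \sum_(y <- undup A) green M (y - x) * esc A y <= 1 :> R.
Proof.
apply: le_trans (_ : 1 - (x \notin A)%:R * esc_upto A M x <= _); last first.
  by rewrite gerBl mulr_ge0 ?esc_upto_ge0.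
rewrite -last_exit exchange_big /=; apply: ler_sum => y _.
rewrite mulr_suml big_ord_recr /= ler_wpDr ?mulr_ge0 ?hk_ge0 ?esc_upto_ge0 //.
by apply: ler_sum => t _; rewrite ler_wpM2l ?hk_ge0 ?esc_le_esc_upto.
Qed.

(** On A the potential of the equilibrium measure equals 1 for the full Green
    function; the last term pays for the truncation at time M. The horizon of
    the escape probabilities is sent to infinity with M fixed. *)
Lemma potential_ge (R : realType) (A : seq 'rV[int]_4) M x : x \in A ->
  1 <= \sum_(y <- undup A) green M (y - x) * esc A y
       + (size A)%:R * ((2 * heat_cst) / (M%:R + 1)) :> R.
Proof.
move=> xA; rewrite -lerBlDr.
have C : (fun k => \sum_(y <- undup A) green M (y - x) * esc_upto A k y : R) @ \oo -->
   (\sum_(y <- undup A) green M (y - x) * esc A y : R).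
  elim: (undup A) => [|y r IH].
    by under eq_fun do rewrite big_nil; rewrite big_nil; exact: cvg_cst.
  under eq_fun do rewrite big_cons; rewrite big_cons; apply: cvgD => //.
  by apply: cvgM; [exact: cvg_cst|exact: esc_cvg].
rewrite -(cvg_lim _ C) //; apply: limr_ge; first by apply/cvg_ex; eexists; exact: C.
apply: nearW => k; rewrite lerBlDr.
have H := last_exit R A (M + k) x; rewrite xA mul0r subr0 in H.
rewrite -[leLHS]H.
rewrite -addnS big_split_ord /= lerD //.
  rewrite exchange_big /=; apply: ler_sum => y _.
  rewrite mulr_suml; apply: ler_sum => t _; rewrite ler_wpM2l ?hk_ge0 // esc_upto_anti //.
  by have := ltn_ord t; lia.
rewrite exchange_big /=.
apply: le_trans (_ : \sum_(y <- undup A) ((2 * heat_cst) / (M%:R + 1)) <= _).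
  apply: ler_sum => y _; apply: le_trans (hk_tail R M k.+1 (y - x)).
  by apply: ler_sum => t _; rewrite ler_piMr ?hk_ge0 ?esc_upto_le1.
rewrite big_const_seq count_predT iter_addr_0 -[((2 * heat_cst) / _) *+ _]mulr_natl ler_wpM2r ?tail_ge0 //.
by rewrite ler_nat size_undup.
Qed.

(** * Capacity and mutual energy *)

(** Capacity of the set of points of a list. Working with lists, possibly
    with repetitions, lets trajectories be used directly; [undup] counts each
    point once. *)
Definition cap {R : realType} (A : seq 'rV[int]_4) : R := \sum_(y <- undup A) esc A y.

Lemma sum_undup_eq_mem (R : realType) (A B : seq 'rV[int]_4) (f : 'rV[int]_4 -> R) :
  A =i B -> \sum_(y <- undup A) f y = \sum_(y <- undup B) f y.
Proof.
move=> AB; apply: perm_big; apply: uniq_perm; rewrite ?undup_uniq // => y.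
by rewrite !mem_undup.
Qed.

Lemma cap_eq_mem (R : realType) (A B : seq 'rV[int]_4) : A =i B -> cap A = cap B :> R.
Proof.
move=> AB; rewrite /cap (sum_undup_eq_mem _ _ _ _ AB); apply: eq_bigr => y _.
exact: esc_eq_mem.
Qed.

Lemma cap_shift (R : realType) (A : seq 'rV[int]_4) z :
  cap [seq z + a | a <- A] = cap A :> R.
Proof.
rewrite /cap undup_map_inj; last exact: addrI.
by rewrite big_map; apply: eq_bigr => y _; rewrite esc_shift.
Qed.

Lemma cap_ge0 (R : realType) A : 0 <= cap A :> R.
Proof. by apply: sumr_ge0 => y _; exact: esc_ge0. Qed.

Lemma sum_undup_cat_le (R : realType) (A B : seq 'rV[int]_4) (f : 'rV[int]_4 -> R) :
  (forall y, 0 <= f y) ->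
  \sum_(y <- undup (A ++ B)) f y <= \sum_(y <- undup A) f y + \sum_(y <- undup B) f y.
Proof.
move=> f0; elim: A => [|a A IH] /=; first by rewrite big_nil add0r.
rewrite mem_cat; case: (boolP (a \in A)) => aA //=.
case: (boolP (a \in B)) => aB; rewrite !big_cons; last by rewrite -addrA lerD2l.
by rewrite -addrA; apply: le_trans IH _; rewrite lerDr.
Qed.

Lemma sum_undup_le (R : realType) (A : seq 'rV[int]_4) (f : 'rV[int]_4 -> R) :
  (forall y, 0 <= f y) -> \sum_(y <- undup A) f y <= \sum_(y <- A) f y.
Proof.
move=> f0; elim: A => [//|a A IH] /=; case: ifP => _; rewrite !big_cons ?lerD2l //.
by apply: le_trans IH _; rewrite lerDr.
Qed.

Lemma cap_le_size (R : realType) A : cap A <= (size A)%:R :> R.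
Proof.
apply: le_trans (sum_undup_le _ _ _ (esc_ge0 _ _)) _.
apply: le_trans (ler_sum _ (fun y _ => esc_le1 R A y)) _.
by rewrite big_const_seq count_predT iter_addr_0.
Qed.

Lemma cap_cat_le (R : realType) A B : cap (A ++ B) <= cap A + cap B :> R.
Proof.
apply: le_trans (sum_undup_cat_le _ _ _ _ (esc_ge0 R (A ++ B))) _.
by apply: lerD; apply: ler_sum => y _; apply: esc_sub => z zA; rewrite mem_cat zA ?orbT.
Qed.

(** Mutual energy of the equilibrium measures of A and B. *)
Definition energy {R : realType} (M : nat) (A B : seq 'rV[int]_4) : R :=
  \sum_(x <- undup A) \sum_(y <- undup B) esc A x * green M (y - x) * esc B y.

Lemma energyC (R : realType) M A B : energy M A B = energy M B A :> R.
Proof.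
rewrite /energy exchange_big; apply: eq_bigr => x _; apply: eq_bigr => y _.
by rewrite -(opprB x) greenN mulrAC [RHS]mulrAC; congr (_ * _); rewrite mulrC.
Qed.

Lemma sum_undup_sub (R : realType) (A F : seq 'rV[int]_4) (f : 'rV[int]_4 -> R) :
  {subset A <= F} ->
  \sum_(z <- undup F) (z \in A)%:R * f z = \sum_(z <- undup A) f z.
Proof.
move=> AF; rewrite (bigID (mem A)) /= [X in _ + X]big1 ?addr0; last first.
  by move=> z /negbTE ->; rewrite mul0r.
rewrite -big_filter; rewrite [RHS](perm_big [seq z <- undup F | z \in A]).
  by rewrite !big_filter; apply: eq_bigr => z ->; rewrite mul1r.
apply: uniq_perm; rewrite ?filter_uniq ?undup_uniq // => z.
rewrite mem_filter !mem_undup; case: (boolP (z \in A)) => //= zA.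
by rewrite AF.
Qed.

(** Let e_F be the equilibrium measure of the union F, and write G for the
    Green function. As G e_F = 1 on A, symmetry of G gives cap A = <e_A, G
    e_F> = <e_F, G e_A>, and likewise for B. At a point of A the potential G
    e_A is at most 1, so the sum of the two identities is at most cap F plus
    the integral of G e_B against e_F over A plus the symmetric term; there
    e_F is at most e_A, respectively e_B. *)
Lemma cap_energy (R : realType) M (A B : seq 'rV[int]_4) :
  cap A + cap B <= cap (A ++ B) + 2 * energy M A B
    + (size A + size B)%:R ^+ 2 * ((2 * heat_cst) / (M%:R + 1)) :> R.
Proof.
pose F := A ++ B; pose tau : R := (2 * heat_cst) / (M%:R + 1).
have tau0 : 0 <= tau by exact: tail_ge0.
pose pot (D : seq 'rV[int]_4) z : R := \sum_(x <- undup D) green M (x - z) * esc D x.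
have pot_ge0 D z : 0 <= pot D z.
  by apply: sumr_ge0 => x _; rewrite mulr_ge0 ?green_ge0 ?esc_ge0.
have capF (D : seq 'rV[int]_4) : {subset D <= F} ->
    cap D <= \sum_(z <- undup F) esc F z * pot D z + (size D)%:R * ((size F)%:R * tau).
  move=> DF; apply: le_trans (_ : \sum_(x <- undup D) (esc D x *
     \sum_(z <- undup F) green M (z - x) * esc F z + (size F)%:R * tau) <= _).
    rewrite /cap big_seq [leRHS]big_seq; apply: ler_sum => x; rewrite mem_undup => xD.
    have := potential_ge R F M x (DF _ xD); rewrite -/tau => H.
    apply: le_trans (_ : esc D x * (\sum_(z <- undup F) green M (z - x) * esc F z
       + (size F)%:R * tau) <= _); first by rewrite ler_peMr ?esc_ge0.
    by rewrite mulrDr lerD2l ler_piMl ?esc_le1 // mulr_ge0.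
  rewrite big_split /=; apply: lerD; last first.
    rewrite big_const_seq count_predT iter_addr_0 -[(_ * tau) *+ _]mulr_natl ler_wpM2r ?mulr_ge0 //.
    by rewrite ler_nat size_undup.
  under eq_bigr => x _ do rewrite mulr_sumr.
  rewrite exchange_big /=; apply: ler_sum => z _; rewrite /pot mulr_sumr.
  apply: ler_sum => x _; rewrite -(opprB x) greenN; lra.
have HA := capF A; have HB := capF B.
have sA : {subset A <= F} by move=> z zA; rewrite mem_cat zA.
have sB : {subset B <= F} by move=> z zA; rewrite mem_cat zA orbT.
apply: le_trans (lerD (HA sA) (HB sB)) _.
rewrite addrACA -/tau -[X in _ + X <= _]mulrDl -[X in X * (_ * tau)]natrD size_cat.
rewrite [X in _ + X <= _]mulrA -expr2.
rewrite lerD2r -big_split /=.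
have E1 : \sum_(z <- undup A) esc A z * pot B z = energy M A B.
  by apply: eq_bigr => x _; rewrite mulr_sumr; apply: eq_bigr => y _; rewrite mulrA.
have E2 : \sum_(z <- undup B) esc B z * pot A z = energy M A B.
  rewrite energyC.
  by apply: eq_bigr => x _; rewrite mulr_sumr; apply: eq_bigr => y _; rewrite mulrA.
apply: le_trans (_ : \sum_(z <- undup F) (esc F z + ((z \in A)%:R * (esc F z * pot B z)
    + (z \in B)%:R * (esc F z * pot A z))) <= _).
  rewrite big_seq [leRHS]big_seq; apply: ler_sum => z; rewrite mem_undup mem_cat => zF.
  have pA := potential_le1 R A M z; have pB := potential_le1 R B M z.
  rewrite -/(pot A z) in pA; rewrite -/(pot B z) in pB.
  have := esc_ge0 R F z; have := pot_ge0 A z; have := pot_ge0 B z.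
  set a := pot A z in pA *; set b := pot B z in pB *; set e := esc F z => b0 a0 e0.
  have ea : e * a <= e by rewrite ler_piMr.
  have eb : e * b <= e by rewrite ler_piMr.
  have ea0 : 0 <= e * a by rewrite mulr_ge0.
  have eb0 : 0 <= e * b by rewrite mulr_ge0.
  move: zF; case: (z \in A); case: (z \in B) => //= _; lra.
rewrite big_split big_split /= !sum_undup_sub //.
rewrite lerD2l mulr_natl mulr2n -{1}E1 -E2.
by apply: lerD; apply: ler_sum => z _; rewrite ler_wpM2r // esc_sub.
Qed.

(** * Cauchy-Schwarz lower bound of the capacity *)

Lemma hk_crossS (R : realFieldType) n (r t : seq (R * 'rV[int]_4)) :
  hk_cross n.+1 r t
  = 8%:R^-1 * \sum_(e : step) hk_cross n [seq (a.1, a.2 + step_vec e) | a <- r] t.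
Proof.
rewrite /hk_cross; under [in RHS]eq_bigr => e _ do rewrite big_map.
rewrite [in RHS]exchange_big mulr_sumr; apply: eq_bigr => a _ /=.
rewrite [in RHS]exchange_big mulr_sumr; apply: eq_bigr => b _ /=.
rewrite hkS mulrCA; congr (_ * _); rewrite mulr_sumr; apply: eq_bigr => e _.
by rewrite addrAC.
Qed.

Lemma hk_form_shift (R : realFieldType) n (r : seq (R * 'rV[int]_4)) z :
  hk_form n [seq (a.1, a.2 + z) | a <- r] = hk_form n r.
Proof.
rewrite /hk_form big_map; apply: eq_bigr => a _; rewrite big_map.
by apply: eq_bigr => b _ /=; rewrite opprD addrACA subrr addr0.
Qed.

(** An odd time is one step after an even time, and the step can be absorbed
    in a translation of the first list, which leaves its form unchanged. *)
Lemma hk_cross_odd_le (R : realFieldType) n (r t : seq (R * 'rV[int]_4)) (c : R) :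
  0 < c ->
  hk_cross n.*2.+1 r t <= (c * hk_form n.*2 r + c^-1 * hk_form n.*2 t) / 2.
Proof.
move=> c0; rewrite hk_crossS.
set b := (X in _ <= X).
apply: le_trans (_ : 8%:R^-1 * \sum_(e : step) b <= _).
  rewrite ler_wpM2l ?invr_ge0 //; apply: ler_sum => e _.
  by apply: le_trans (hk_cross_le _ _ _ _ _ c0) _; rewrite hk_form_shift.
rewrite big_const iter_addr_0 card_step -[b *+ 8]mulr_natl mulrA mulVf ?mul1r //.
Qed.

Lemma sum_pairs (R : realFieldType) (f : nat -> R) M :
  \sum_(t < M.*2) f t = \sum_(s < M) (f s.*2 + f s.*2.+1).
Proof.
elim: M => [|M IH]; first by rewrite !big_ord0.
by rewrite doubleS !big_ord_recr /= IH addrA.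
Qed.

Lemma green_cross_le (R : realFieldType) M (r t : seq (R * 'rV[int]_4)) (c : R) :
  0 < c -> (forall a, a \in r -> 0 <= a.1) -> (forall a, a \in t -> 0 <= a.1) ->
  \sum_(a <- r) \sum_(b <- t) a.1 * b.1 * green M.*2 (a.2 - b.2)
  <= c * (\sum_(a <- r) \sum_(b <- r) a.1 * b.1 * green M.*2 (a.2 - b.2))
   + c^-1 * (\sum_(a <- t) \sum_(b <- t) a.1 * b.1 * green M.*2 (a.2 - b.2)).
Proof.
move=> c0 r0 t0.
have E (u v : seq (R * 'rV[int]_4)) :
    \sum_(a <- u) \sum_(b <- v) a.1 * b.1 * green M.*2 (a.2 - b.2)
    = \sum_(s < M) (hk_cross s.*2 u v + hk_cross s.*2.+1 u v).
  rewrite -(sum_pairs R (fun s => hk_cross s u v)) [in RHS]exchange_big /=; apply: eq_bigr => a _.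
  rewrite [in RHS]exchange_big /=; apply: eq_bigr => b _.
  by rewrite -mulr_sumr.
have P (u : seq (R * 'rV[int]_4)) n : (forall a, a \in u -> 0 <= a.1) -> 0 <= hk_cross n u u.
  move=> u0; rewrite /hk_cross big_seq; apply: sumr_ge0 => a au; rewrite big_seq.
  by apply: sumr_ge0 => b bu; rewrite mulr_ge0 ?hk_ge0 ?mulr_ge0 ?u0.
rewrite !E !mulr_sumr -big_split /=; apply: ler_sum => s _.
have h1 := hk_cross_le R s r t c c0; have h2 := hk_cross_odd_le R s r t c c0.
have h3 : 0 <= c * hk_cross s.*2.+1 r r by rewrite mulr_ge0 ?P // ltW.
have h4 : 0 <= c^-1 * hk_cross s.*2.+1 t t by rewrite mulr_ge0 ?P // invr_ge0 ltW.
have e1 : hk_form s.*2 r = hk_cross s.*2 r r by [].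
have e2 : hk_form s.*2 t = hk_cross s.*2 t t by [].
rewrite e1 e2 in h1 h2; lra.
Qed.

(** Cauchy-Schwarz for the energy form, applied to the counting measure of
    the list and to its equilibrium measure: the cross energy is the number
    of points (up to truncation) since the equilibrium potential is 1 on A,
    and the energy of the equilibrium measure is at most cap A. *)
Lemma cap_lower (R : realType) M (A : seq 'rV[int]_4) (c : R) : 0 < c ->
  (size A)%:R <= c * (\sum_(x <- A) \sum_(y <- A) green M.*2 (x - y)) + c^-1 * cap A
     + (size A)%:R ^+ 2 * ((2 * heat_cst) / (M.*2%:R + 1)).
Proof.
move=> c0; set tau := (2 * heat_cst) / _.
apply: le_trans (_ : \sum_(x <- A) (\sum_(y <- undup A) green M.*2 (x - y) * esc A y
    + (size A)%:R * tau) <= _).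
  rewrite -[X in X%:R <= _]mul1n -iter_addn_0 -count_predT -big_const_seq natr_sum.
  rewrite big_seq [leRHS]big_seq; apply: ler_sum => x xA.
  have := potential_ge R A M.*2 x xA.
  by under eq_bigr => y _ do rewrite -(opprB x) greenN.
rewrite big_split /= big_const_seq count_predT iter_addr_0 -[(_ * tau) *+ _]mulr_natl mulrA -expr2.
rewrite lerD2r.
have := @green_cross_le R M [seq (1, x) | x <- A] [seq (esc A y, y) | y <- undup A] c c0.
have h1 a : a \in [seq (1 : R, x) | x <- A] -> 0 <= a.1 by case/mapP => x _ ->.
have h2 a : a \in [seq (esc A y : R, y) | y <- undup A] -> 0 <= a.1.
  by case/mapP => x _ -> /=; exact: esc_ge0.
move=> /(_ h1 h2).
have e (u v : seq 'rV[int]_4) (f g : 'rV[int]_4 -> R) :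
    \sum_(a <- [seq (f x, x) | x <- u]) \sum_(b <- [seq (g x, x) | x <- v])
      a.1 * b.1 * green M.*2 (a.2 - b.2)
    = \sum_(x <- u) \sum_(y <- v) f x * g y * green M.*2 (x - y).
  by rewrite big_map; apply: eq_bigr => x _; rewrite big_map.
rewrite !e.
have -> : \sum_(x <- A) \sum_(y <- undup A) 1 * esc A y * green M.*2 (x - y)
    = \sum_(x <- A) \sum_(y <- undup A) green M.*2 (x - y) * esc A y :> R.
  by apply: eq_bigr => x _; apply: eq_bigr => y _; rewrite mul1r mulrC.
have -> : \sum_(x <- A) \sum_(y <- A) 1 * 1 * green M.*2 (x - y)
    = \sum_(x <- A) \sum_(y <- A) green M.*2 (x - y) :> R.
  by apply: eq_bigr => x _; apply: eq_bigr => y _; rewrite !mul1r.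
move/le_trans; apply; rewrite lerD2l ler_wpM2l ?invr_ge0 ?(ltW c0) //.
apply: ler_sum => x _.
under eq_bigr => y _ do rewrite -mulrA -(opprB y) greenN [esc A y * _]mulrC.
by rewrite -mulr_sumr ler_piMr ?esc_ge0 ?potential_le1.
Qed.

(** * Capacity of the range of the walk *)

Fixpoint traj (x : 'rV[int]_4) (s : seq step) : seq 'rV[int]_4 :=
  x :: if s is e :: s' then traj (x + step_vec e) s' else [::].

Lemma size_traj x s : size (traj x s) = (size s).+1.
Proof. by elim: s x => [//|e s IH] x /=; rewrite IH. Qed.

Lemma traj_shift z x s : traj (z + x) s = [seq z + y | y <- traj x s].
Proof. by elim: s x => [//|e s IH] x /=; rewrite -addrA IH. Qed.

Lemma nth_traj x s k : (k <= size s)%N -> nth 0 (traj x s) k = x + pos (take k s).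
Proof.
elim: s x k => [|e s IH] x [|k] //= ks; rewrite ?take0 ?pos_nil ?addr0 //.
by rewrite IH // pos_cons addrA.
Qed.

Lemma mem_traj_head x s : x \in traj x s.
Proof. by case: s => [|e s] /=; rewrite inE eqxx. Qed.

Lemma traj_cat x s t : traj x (s ++ t) =i traj x s ++ traj (x + pos s) t.
Proof.
elim: s x => [|e s IH] x y.
  rewrite /= pos_nil addr0 inE; case: eqP => [->|//]; by rewrite mem_traj_head.
by rewrite /= !inE IH pos_cons addrA.
Qed.

Lemma sum_traj (R : realFieldType) x s (f : 'rV[int]_4 -> R) :
  \sum_(y <- traj x s) f y = \sum_(k < (size s).+1) f (x + pos (take k s)).
Proof.
rewrite (big_nth 0) size_traj big_mkord; apply: eq_bigr => k _.
by rewrite nth_traj // -ltnS.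
Qed.

Definition walkcap {R : realType} (s : seq step) : R := cap (traj 0 s).

Definition mean_cap {R : realType} (n : nat) : R := Ex n walkcap.

Lemma cap_traj (R : realType) x s : cap (traj x s) = walkcap s :> R.
Proof. by rewrite -[x]addr0 traj_shift cap_shift. Qed.

Lemma walkcap_ge0 (R : realType) s : 0 <= walkcap s :> R.
Proof. exact: cap_ge0. Qed.

Lemma mean_cap_ge0 (R : realType) n : 0 <= mean_cap n :> R.
Proof. by apply: Ex_ge0 => s _; exact: walkcap_ge0. Qed.

Lemma walkcap_le (R : realType) s : walkcap s <= (size s).+1%:R :> R.
Proof. by rewrite -(size_traj 0); exact: cap_le_size. Qed.

Lemma walkcap_cat (R : realType) s t : walkcap (s ++ t) <= walkcap s + walkcap t :> R.
Proof.
rewrite -(cap_traj R (0 + pos s) t) /walkcap (cap_eq_mem _ _ _ (traj_cat 0 s t)).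
exact: cap_cat_le.
Qed.

(** * The mean capacity is at least of order n / log n *)

(** Harmonic numbers play the role of the logarithm throughout. *)
Definition harm {R : realFieldType} (n : nat) : R := \sum_(i < n) (i%:R + 1)^-1.

Lemma harm_ge0 (R : realFieldType) n : 0 <= harm n :> R.
Proof. by apply: sumr_ge0 => i _; rewrite invr_ge0 addr_ge0. Qed.

Lemma harm_le (R : realFieldType) m n : (m <= n)%N -> harm m <= harm n :> R.
Proof.
move=> mn; rewrite -(subnKC mn); elim: (n - m)%N => [|d IH]; first by rewrite addn0.
by rewrite addnS /harm big_ord_recr /= ler_wpDr ?invr_ge0 ?addr_ge0.
Qed.

Lemma harm_ge1 (R : realFieldType) n : (0 < n)%N -> 1 <= harm n :> R.
Proof. by move=> /(harm_le R); apply: le_trans; rewrite /harm big_ord1 add0r invr1. Qed.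

Lemma sum_dist_le (R : realFieldType) n k : (k < n)%N ->
  \sum_(j < n) ((j - k)%:R + (k - j)%:R + 1)^-1 <= 2 * harm n :> R.
Proof.
move=> kn; rewrite mulr_natl mulr2n.
suff : \sum_(j < k.+1 + (n - k.+1)) ((j - k)%:R + (k - j)%:R + 1)^-1 <= harm n + harm n :> R.
  by rewrite subnKC.
rewrite big_split_ord /=; apply: lerD.
  apply: le_trans (harm_le R _ _ kn); rewrite /harm (reindex_inj rev_ord_inj) /=.
  apply: ler_sum => i _; have := ltn_ord i => ik.
  have e1 : (k.+1 - i.+1 - k = 0)%N by clear -ik; lia.
  have e2 : (k - (k.+1 - i.+1) = i)%N by clear -ik; lia.
  by rewrite e1 e2 add0r.
apply: le_trans (harm_le R _ _ (leq_subr k.+1 n)); apply: ler_sum => i _.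
rewrite lef_pV2 ?posrE ?ltr_wpDl ?addr_ge0 // lerD2r ler_wpDr // ler_nat; lia.
Qed.

(** The increment between times k and j is a walk of |j - k| steps, and
    averaging the Green function over it shifts its time range by |j - k|. *)
Lemma Ex_green_diff (R : realFieldType) M n j k : (j <= n)%N -> (k <= n)%N ->
  Ex n (fun s => green M (pos (take j s) - pos (take k s)))
  <= (2 * heat_cst) / ((j - k)%:R + (k - j)%:R + 1) :> R.
Proof.
wlog kj : j k / (k <= j)%N => [H|].
  case: (leqP k j) => [|/ltnW] kj jn kn; first exact: H.
  rewrite [(j - k)%:R + _]addrC; apply: le_trans (H _ _ kj kn jn).
  by apply: Ex_le => s _; rewrite -opprB greenN.
move=> jn _.
have -> : Ex n (fun s => green M (pos (take j s) - pos (take k s)))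
   = Ex n (fun s => green M (pos (drop k (take j s)))) :> R.
  apply: Ex_ext => s _; congr (green _ _).
  rewrite -{1}(cat_take_drop k (take j s)) pos_cat take_takel //.
  by rewrite addrC addKr.
rewrite (Ex_take R j n (fun s => green M (pos (drop k s)))) //.
rewrite (Ex_drop R k j (fun s => green M (pos s))) //.
under Ex_ext => s _ do rewrite -[pos s]add0r.
rewrite Ex_green (_ : k - j = 0)%N ?addr0; last lia.
exact: hk_tail.
Qed.

Definition cap_lo_cst {R : realFieldType} : R := 32%:R * heat_cst.

Lemma cap_lo_cst_gt0 (R : realFieldType) : 0 < cap_lo_cst :> R.
Proof. by rewrite /cap_lo_cst mulr_gt0 ?heat_cst_gt0. Qed.

(** By [cap_lower] with c of order 1 / log n: the expected energy of the
    occupation measure is at most of order n log n, because E[G(X_j - X_k)]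
    is O(1 / (|j - k| + 1)). *)
Lemma mean_cap_ge (R : realType) n : n.+1%:R / (cap_lo_cst * harm n.+1) <= mean_cap n :> R.
Proof.
rewrite /cap_lo_cst.
set h : R := harm n.+1; have h1 : 1 <= h by exact: harm_ge1.
have h0 : 0 < h by apply: lt_le_trans h1.
have C0 := heat_cst_gt0 R.
have p0 : 0 < 16%:R * heat_cst * h by rewrite !mulr_gt0.
pose c : R := (16%:R * heat_cst * h)^-1.
have c0 : 0 < c by rewrite invr_gt0.
have n0 : 0 < n.+1%:R :> R by rewrite ltr0n.
(* N makes the truncation term at most a quarter of n + 1. *)
pose N := Num.bound (8%:R * n.+1%:R * heat_cst : R).
have NP : 8%:R * n.+1%:R * heat_cst <= N%:R :> R.
  by rewrite ltW // archi_boundP // !mulr_ge0 // ltW.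
have key : n.+1%:R <= c * (4%:R * heat_cst * n.+1%:R * h) + c^-1 * mean_cap n
     + n.+1%:R ^+ 2 * ((2 * heat_cst) / (N.*2%:R + 1)).
  rewrite -[X in X <= _](Ex_cst R n); apply: le_trans (_ : Ex n (fun s =>
    c * (\sum_(x <- traj 0 s) \sum_(y <- traj 0 s) green N.*2 (x - y)) + c^-1 * walkcap s
     + n.+1%:R ^+ 2 * ((2 * heat_cst) / (N.*2%:R + 1))) <= _).
    by apply: Ex_le => s ss; have := cap_lower R N (traj 0 s) c c0; rewrite size_traj ss.
  rewrite !ExD Ex_cst !ExZ lerD2r lerD2r ler_wpM2l ?(ltW c0) //.
  apply: le_trans (_ : \sum_(j < n.+1) \sum_(k < n.+1)
    (2 * heat_cst) * ((k - j)%:R + (j - k)%:R + 1)^-1 <= _).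
    rewrite (_ : Ex n _ = \sum_(j < n.+1) \sum_(k < n.+1)
      Ex n (fun s => green N.*2 (pos (take k s) - pos (take j s)))).
      apply: ler_sum => j _; apply: ler_sum => k _.
      by apply: Ex_green_diff; rewrite -ltnS.
    under [in RHS]eq_bigr => j _ do rewrite -Ex_sum.
    rewrite -Ex_sum; apply: Ex_ext => s ss; rewrite sum_traj ss; apply: eq_bigr => j _.
    by rewrite sum_traj ss; apply: eq_bigr => k _; rewrite !add0r -opprB greenN.
  rewrite (_ : 4%:R * heat_cst * _ * h = \sum_(j < n.+1) ((2 * heat_cst) * (2 * h))); last first.
    by rewrite big_const iter_addr_0 card_ord -[_ *+ n.+1]mulr_natl; ring.
  apply: ler_sum => j _; rewrite -mulr_sumr; apply: ler_wpM2l; first exact: twice_heat_cst_ge0.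
  exact/sum_dist_le/ltn_ord.
have t1 : n.+1%:R ^+ 2 * ((2 * heat_cst) / (N.*2%:R + 1)) <= n.+1%:R / 4%:R :> R.
  rewrite mulrA ler_pdivrMr ?ltr_wpDl // -mul2n natrM.
  have : n.+1%:R * (8%:R * n.+1%:R * heat_cst) <= n.+1%:R * N%:R :> R by rewrite ler_wpM2l // ltW.
  have zN : 0 <= n.+1%:R * N%:R :> R by rewrite mulr_ge0.
  by move: n0 zN; set z : R := n.+1%:R; lra.
have t2 : c * (4%:R * heat_cst * n.+1%:R * h) = n.+1%:R / 4%:R.
  by rewrite /c; field; rewrite !gt_eqF.
have t3 : n.+1%:R / 2 <= c^-1 * mean_cap n by lra.
have -> : n.+1%:R / (32%:R * heat_cst * h) = (n.+1%:R / 2) / (16%:R * heat_cst * h).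
  by field; rewrite !gt_eqF.
by move: t3; rewrite /c invrK (ler_pdivrMr _ _ p0) [mean_cap n * _]mulrC.
Qed.

Global Opaque cap_lo_cst.

(** * Concentration of the self-potential of the walk *)

(** Restricting the Green function and the walk to even times removes parity
    effects: then the mean of the Green function seen from x is at most the
    one seen from 0, with no loss of constant. *)
Definition green_even {R : realFieldType} (M : nat) (x : 'rV[int]_4) : R :=
  \sum_(s < M) hk s.*2 x.

(** Mean of [green_even M] at the position of the walk at time 2t. *)
Definition mean_green_even {R : realFieldType} (M t : nat) : R := \sum_(s < M) hk (t.*2 + s.*2) 0.

Lemma green_even_ge0 (R : realFieldType) M x : 0 <= green_even M x :> R.
Proof. by apply: sumr_ge0 => s _; apply: hk_ge0. Qed.

Lemma mean_green_even_ge0 (R : realFieldType) M t : 0 <= mean_green_even M t :> R.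
Proof. by apply: sumr_ge0 => s _; apply: hk_ge0. Qed.

Lemma green_even_le_green (R : realFieldType) M x : green_even M x <= green M.*2 x :> R.
Proof.
rewrite /green (sum_pairs R (fun t => hk t x)); apply: ler_sum => s _.
by rewrite lerDl hk_ge0.
Qed.

Lemma Ex_green_even (R : realFieldType) M t x :
  Ex t.*2 (fun s => green_even M (x + pos s)) = \sum_(s < M) hk (t.*2 + s.*2) x :> R.
Proof. by rewrite Ex_sum; apply: eq_bigr => i _; rewrite hk_add. Qed.

Lemma Ex_green_even_le (R : realFieldType) M t x :
  Ex t.*2 (fun s => green_even M (x + pos s)) <= mean_green_even M t :> R.
Proof. by rewrite Ex_green_even; apply: ler_sum => s _; rewrite -doubleD hk_even_max. Qed.

Lemma Ex_green_even_ge0 (R : realFieldType) M t x :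
  0 <= Ex t.*2 (fun s => green_even M (x + pos s)) :> R.
Proof. by apply: Ex_ge0 => s _; exact: green_even_ge0. Qed.

Lemma tail_anti (R : realFieldType) m n : (m <= n)%N ->
  (2 * heat_cst) / (n%:R + 1) <= (2 * heat_cst) / (m%:R + 1) :> R.
Proof.
by move=> mn; rewrite ler_wpM2l ?twice_heat_cst_ge0 // lef_pV2 ?posrE ?ltr_wpDl // lerD2r ler_nat.
Qed.

Lemma mean_green_even_le (R : realFieldType) M t : mean_green_even M t <= (2 * heat_cst) / (t%:R + 1) :> R.
Proof.
apply: le_trans (hk_tail_mul R t.*2 M 0) _; apply: tail_anti; lia.
Qed.

Lemma Ex_Ex_green_even_le (R : realFieldType) M i t :
  Ex i.*2 (fun s => Ex t.*2 (fun s' => green_even M (pos s + pos s')))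
  <= (2 * heat_cst) / ((i + t)%:R + 1) :> R.
Proof.
under Ex_ext => s _ do rewrite Ex_green_even.
rewrite Ex_sum; apply: le_trans (mean_green_even_le _ M (i + t)).
apply: ler_sum => j _.
under Ex_ext => s _ do rewrite -[pos s]add0r.
by rewrite hk_add doubleD addnA.
Qed.

Lemma sum_inv_square (R : realFieldType) i :
  \sum_(s < i) \sum_(t < i) ((s + t)%:R + 1)^-1 <= 3%:R * i%:R :> R.
Proof.
elim: i => [|i IH]; first by rewrite big_ord0 mulr0.
under eq_bigr => s _ do rewrite big_ord_recr /=.
rewrite big_split /= !big_ord_recr /= -[i.+1%:R]natr1 mulrDr mulr1 -!addrA.
apply: lerD => //.
have i0 : 0 <= i%:R :> R by [].
have H (s : 'I_i) : (((s + i)%:R + 1)^-1 <= (i%:R + 1)^-1 :> R) * (((i + s)%:R + 1)^-1 <= (i%:R + 1)^-1 :> R).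
  by split; rewrite lef_pV2 ?posrE ?ltr_wpDl // lerD2r ler_nat ?leq_addl ?leq_addr.
have S1 : \sum_(s < i) ((s + i)%:R + 1)^-1 <= 1 :> R.
  apply: le_trans (ler_sum _ (fun s _ => (H s).1)) _.
  rewrite big_const iter_addr_0 card_ord -[_ *+ i]mulr_natl ler_pdivrMr ?ltr_wpDl //.
  by rewrite mul1r lerDl.
have S2 : \sum_(s < i) ((i + s)%:R + 1)^-1 <= 1 :> R.
  apply: le_trans (ler_sum _ (fun s _ => (H s).2)) _.
  rewrite big_const iter_addr_0 card_ord -[_ *+ i]mulr_natl ler_pdivrMr ?ltr_wpDl //.
  by rewrite mul1r lerDl.
have S3 : ((i + i)%:R + 1)^-1 <= 1 :> R by rewrite invf_le1 ?ltr_wpDl // lerDr.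
lra.
Qed.

(** Correlations at times 2i and 2(i+t) with t < i. The part of the Green
    function after time 2i is at most O(1/i) everywhere; for the part before,
    [Ex_hk_swap] replaces the law at time 2i by its uniform bound O(i^(-2)),
    and the remaining double sum of 1/(s+t) over s, t < i is O(i). *)
Lemma near_correlation (R : realFieldType) M i :
  \sum_(t < i) Ex i.*2 (fun s => green_even M (pos s) * Ex t.*2 (fun s' => green_even M (pos s + pos s')))
  <= 10%:R * heat_cst ^+ 2 / (i%:R + 1) :> R.
Proof.
have i1 : 0 < i%:R + 1 :> R by rewrite ltr_wpDl.
pose E (j t : nat) : R := Ex j.*2 (fun s => Ex t.*2 (fun s' => green_even M (pos s + pos s'))).
apply: le_trans (_ : \sum_(t < i) (heat_cst / (i%:R + 1) ^+ 2 *
   (\sum_(s < i) (2 * heat_cst) * ((s + t)%:R + 1)^-1) + ((2 * heat_cst) / (i%:R + 1)) ^+ 2) <= _).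
  apply: ler_sum => t _.
  apply: le_trans (_ : Ex i.*2 (fun s =>
     \sum_(j < i) hk j.*2 (pos s) * Ex t.*2 (fun s' => green_even M (pos s + pos s')) +
     (2 * heat_cst) / (i%:R + 1) * Ex t.*2 (fun s' => green_even M (pos s + pos s'))) <= _).
    apply: Ex_le => s _; rewrite -mulr_suml -mulrDl ler_wpM2r ?Ex_green_even_ge0 //.
    apply: le_trans (_ : \sum_(j < i + M) hk j.*2 (pos s) <= _).
      rewrite addnC big_split_ord /= lerDl; apply: sumr_ge0 => j _; exact: hk_ge0.
    rewrite big_split_ord /= lerD2l.
    under eq_bigr => j _ do rewrite doubleD.
    apply: le_trans (hk_tail_mul R i.*2 M (pos s)) _; apply: tail_anti; lia.
  rewrite ExD Ex_sum ExZ; apply: lerD.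
    rewrite mulr_sumr; apply: ler_sum => j _.
    rewrite (Ex_hk_swap R j.*2 i.*2 (fun x => Ex t.*2 (fun s' => green_even M (x + pos s')))).
    apply: le_trans (_ : heat_cst / (i%:R + 1) ^+ 2 * E j t <= _); last first.
      by rewrite ler_wpM2l ?Ex_Ex_green_even_le // divr_ge0 ?heat_cst_ge0 // sqr_ge0.
    rewrite -ExZ; apply: Ex_le => s _; rewrite ler_wpM2r ?Ex_green_even_ge0 //.
    apply: le_trans (hk_le _ _ _) _; rewrite ler_wpM2l ?heat_cst_ge0 // lef_pV2 ?posrE ?exprn_gt0 ?ltr_wpDl //.
    rewrite ler_sqr ?nnegrE ?addr_ge0 // lerD2r ler_nat; lia.
  rewrite expr2 ler_wpM2l ?tail_ge0 //.
  apply: le_trans (Ex_Ex_green_even_le _ _ _ _) _; apply: tail_anti; lia.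
rewrite big_split /= -mulr_sumr big_const iter_addr_0 card_ord -[(_ ^+ 2) *+ i]mulr_natl.
rewrite exchange_big /=.
have -> : \sum_(j < i) \sum_(t < i) (2 * heat_cst) * ((j + t)%:R + 1)^-1
   = (2 * heat_cst) * \sum_(j < i) \sum_(t < i) ((j + t)%:R + 1)^-1 :> R.
  by rewrite mulr_sumr; apply: eq_bigr => j _; rewrite mulr_sumr.
have H := sum_inv_square R i.
apply: le_trans (_ : heat_cst / (i%:R + 1) ^+ 2 * ((2 * heat_cst) * (3%:R * i%:R)) +
   i%:R * ((2 * heat_cst) / (i%:R + 1)) ^+ 2 <= _).
  by rewrite lerD2r ler_wpM2l ?divr_ge0 ?sqr_ge0 ?heat_cst_ge0 // ler_wpM2l ?twice_heat_cst_ge0.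
rewrite -subr_ge0; set z : R := i%:R in i1 *.
have -> : 10%:R * heat_cst ^+ 2 / (z + 1) - (heat_cst / (z + 1) ^+ 2 * ((2 * heat_cst) * (3%:R * z)) +
   z * ((2 * heat_cst) / (z + 1)) ^+ 2) = 10%:R * heat_cst ^+ 2 / (z + 1) ^+ 2.
  by field; rewrite gt_eqF.
by rewrite divr_ge0 ?sqr_ge0 // mulr_ge0 ?sqr_ge0.
Qed.

(** Potential at the starting point of the occupation measure of the walk at
    even times, up to time 2r. It is of order log r, with fluctuations of
    order sqrt (log r). *)
Definition self_potential {R : realFieldType} (M r : nat) (s : seq step) : R :=
  \sum_(i < r) green_even M (pos (take i.+1.*2 s)).

Definition mean_self_potential {R : realFieldType} (M r : nat) : R := \sum_(i < r) mean_green_even M i.+1.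

Lemma Ex_self_potential (R : realFieldType) M r :
  Ex r.*2 (self_potential M r) = mean_self_potential M r :> R.
Proof.
rewrite Ex_sum; apply: eq_bigr => i _.
rewrite (Ex_take R _ _ (fun s => green_even M (pos s))); last first.
  by rewrite leq_double; exact: ltn_ord.
under Ex_ext => s _ do rewrite -[pos s]add0r.
by rewrite Ex_green_even.
Qed.

(** Markov property at times 2i and 2(i+t). *)
Lemma Ex_green_even2 (R : realFieldType) M r i t : (i + t <= r)%N ->
  Ex r.*2 (fun s => green_even M (pos (take i.*2 s)) * green_even M (pos (take (i + t).*2 s)))
  = Ex i.*2 (fun s => green_even M (pos s) * Ex t.*2 (fun s' => green_even M (pos s + pos s'))) :> R.
Proof.
move=> itr.
have e : (r.*2 = i.*2 + (t.*2 + (r - i - t).*2))%N by lia.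
rewrite e Ex_cat; apply: Ex_ext => s ss.
rewrite -ExZ Ex_cat; apply: Ex_ext => s' ss'.
rewrite -[RHS](Ex_cst R (r - i - t).*2); apply: Ex_ext => s'' _.
rewrite -ss take_size_cat // doubleD takeD.
by rewrite -ss take_size_cat // drop_size_cat // -ss' take_size_cat // pos_cat.
Qed.

Lemma sum_sym_le (R : realFieldType) r (a : nat -> nat -> R) :
  (forall i j, 0 <= a i j) -> (forall i j, a i j = a j i) ->
  \sum_(i < r) \sum_(j < r) a i j <= 2 * \sum_(i < r) \sum_(i <= j < r) a i j.
Proof.
move=> a0 aC.
have E : \sum_(i < r) \sum_(i <= j < r) a i j = \sum_(i < r) \sum_(j < r) (i <= j)%:R * a i j.
  apply: eq_bigr => i _; rewrite (big_nat_widenl _ 0) // big_mkord big_mkcond /=.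
  by apply: eq_bigr => j _; case: leqP => _; rewrite ?mul1r ?mul0r.
have E' : \sum_(i < r) \sum_(i <= j < r) a i j = \sum_(i < r) \sum_(j < r) (j <= i)%:R * a i j.
  rewrite E exchange_big; apply: eq_bigr => i _; apply: eq_bigr => j _.
  by rewrite aC.
rewrite mulr_natl mulr2n {1}E E' -big_split /=; apply: ler_sum => i _.
rewrite -big_split /=; apply: ler_sum => j _; rewrite -mulrDl ler_peMl //.
by case: (leqP i j) => [_|/ltnW ->]; rewrite ?lerDl ?add0r ?ler0n.
Qed.

Lemma sum_triangle (R : realFieldType) r (g : nat -> R) :
  2 * (\sum_(i < r) \sum_(i <= j < r) g i * g j)
  = (\sum_(i < r) g i) ^+ 2 + \sum_(i < r) g i ^+ 2.
Proof.
elim: r => [|r IH]; first by rewrite !big_ord0 expr0n mulr0 addr0.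
have -> : \sum_(i < r.+1) \sum_(i <= j < r.+1) g i * g j
  = \sum_(i < r) \sum_(i <= j < r) g i * g j + (\sum_(i < r) g i) * g r + g r ^+ 2.
  rewrite big_ord_recr /= big_nat1 -expr2; congr (_ + _).
  rewrite mulr_suml -big_split /=; apply: eq_bigr => i _.
  by rewrite big_nat_recr //= ltnW.
by rewrite !mulrDr IH !big_ord_recr /=; ring.
Qed.

(** Pairs of times 2i < 2(i+t) with t >= i contribute at most the product of
    the means, and over ordered pairs these products add up to half of the
    squared mean, up to the diagonal. The pairs with t < i contribute O(1/i)
    for each i, which gives the error of order log r. *)
Lemma self_potential_sqr (R : realFieldType) M r :
  Ex r.*2 (fun s => self_potential M r s ^+ 2)
  <= mean_self_potential M r ^+ 2 + 24%:R * heat_cst ^+ 2 * harm r :> R.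
Proof.
pose a (i j : nat) : R :=
  Ex r.*2 (fun s => green_even M (pos (take i.+1.*2 s)) * green_even M (pos (take j.+1.*2 s))).
have a0 i j : 0 <= a i j by apply: Ex_ge0 => s _; rewrite mulr_ge0 ?green_even_ge0.
have aC i j : a i j = a j i by apply: Ex_ext => s _; rewrite mulrC.
have -> : Ex r.*2 (fun s => self_potential M r s ^+ 2) = \sum_(i < r) \sum_(j < r) a i j.
  under [RHS]eq_bigr => i _ do rewrite -Ex_sum.
  rewrite -Ex_sum; apply: Ex_ext => s _; rewrite expr2 mulr_suml.
  by apply: eq_bigr => i _; rewrite mulr_sumr.
apply: le_trans (sum_sym_le _ _ _ a0 aC) _.
pose b (i t : nat) : R :=
  Ex i.*2 (fun s => green_even M (pos s) * Ex t.*2 (fun s' => green_even M (pos s + pos s'))).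
have b0 i t : 0 <= b i t.
  by apply: Ex_ge0 => s _; rewrite mulr_ge0 ?green_even_ge0 ?Ex_green_even_ge0.
have b_far i t : b i t <= mean_green_even M i * mean_green_even M t.
  apply: le_trans (_ : Ex i.*2 (fun s => green_even M (pos s) * mean_green_even M t) <= _).
    by apply: Ex_le => s _; rewrite ler_wpM2l ?green_even_ge0 ?Ex_green_even_le.
  rewrite ExZr ler_wpM2r ?mean_green_even_ge0 //.
  by under Ex_ext => s _ do rewrite -[pos s]add0r; rewrite Ex_green_even.
pose K : R := 10%:R * heat_cst ^+ 2.
have row (i : 'I_r) : \sum_(i <= j < r) a i j
    <= K / (i%:R + 1) + \sum_(i <= j < r) mean_green_even M i.+1 * mean_green_even M j.+1.
  have near : \sum_(0 <= t < i.+1) b i.+1 t <= K / (i%:R + 1).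
    rewrite big_mkord; apply: le_trans (near_correlation R M i.+1) _; rewrite -/K ler_wpM2l //.
      by rewrite mulr_ge0 ?sqr_ge0.
    by rewrite lef_pV2 ?posrE ?ltr_wpDl // lerD2r ler_nat.
  have -> : \sum_(i <= j < r) a i j = \sum_(0 <= t < r - i) b i.+1 t.
    rewrite -{1}[i : nat]add0n big_addn big_nat_cond [RHS]big_nat_cond.
    apply: eq_bigr => t /andP[/andP[_ tr] _].
    rewrite /a /b -(Ex_green_even2 R M r); last by move: tr; have := ltn_ord i; lia.
    by rewrite addSn [(t + i)%N]addnC.
  case: (leqP (r - i) i.+1) => ri.
    apply: le_trans (_ : \sum_(0 <= t < i.+1) b i.+1 t <= _).
      by rewrite [leRHS](big_cat_nat (leq0n _) ri) /= lerDl sumr_ge0.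
    apply: le_trans near _; rewrite lerDl; apply: sumr_ge0 => j _.
    by rewrite mulr_ge0 ?mean_green_even_ge0.
  rewrite (big_cat_nat (leq0n _) (ltnW ri)) /=; apply: lerD => //.
  apply: le_trans (_ : \sum_(i.+1 <= t < r - i) mean_green_even M i.+1 * mean_green_even M t <= _).
    by apply: ler_sum => t _; exact: b_far.
  apply: le_trans (_ : \sum_(i.+1 <= t < r.+1) mean_green_even M i.+1 * mean_green_even M t <= _).
    have h : (r - i <= r.+1)%N by lia.
    rewrite [leRHS](big_cat_nat (ltnW ri) h) /= lerDl; apply: sumr_ge0 => j _.
    by rewrite mulr_ge0 ?mean_green_even_ge0.
  by rewrite big_add1.
apply: le_trans (_ : 2 * (\sum_(i < r) (K / (i%:R + 1)
    + \sum_(i <= j < r) mean_green_even M i.+1 * mean_green_even M j.+1)) <= _).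
  by rewrite ler_wpM2l //; apply: ler_sum => i _; exact: row.
rewrite big_split /= mulrDr (sum_triangle R r (fun i => mean_green_even M i.+1)) -mulr_sumr -/(harm r).
rewrite addrCA lerD2l.
apply: le_trans (_ : 2 * (K * harm r) + (2 * heat_cst) ^+ 2 * harm r <= _); last first.
  by rewrite /K le_eqVlt; apply/orP; left; apply/eqP; ring.
rewrite lerD2l /harm mulr_sumr; apply: ler_sum => i _.
have h := mean_green_even_le R M i.+1; have h0 := mean_green_even_ge0 R M i.+1.
have i1 : 1 <= i%:R + 1 :> R by rewrite lerDr.
have h' : mean_green_even M i.+1 <= (2 * heat_cst) / (i%:R + 1) :> R.
  by apply: le_trans h (tail_anti _ _ _ _).
apply: le_trans (_ : ((2 * heat_cst) / (i%:R + 1)) ^+ 2 <= _).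
  by rewrite ler_sqr ?nnegrE // (le_trans h0 h').
rewrite expr_div_n ler_wpM2l ?sqr_ge0 // lef_pV2 ?posrE ?exprn_gt0 //; try lra.
by rewrite expr2 ler_peMl //; lra.
Qed.

(** The mean at time 2i is a sum of return probabilities over times beyond
    2i, at least i terms of order i^(-2). *)
Lemma mean_self_potential_ge (R : realFieldType) M r : (r <= M)%N ->
  harm r / (4%:R * return_cst) <= mean_self_potential M r :> R.
Proof.
move=> rM; rewrite /harm mulr_suml; apply: ler_sum => i _.
have iM : (i.+1 <= M)%N by apply: leq_trans rM; exact: ltn_ord.
have z0 : 0 < i.+1%:R :> R by rewrite ltr0n.
apply: le_trans (_ : \sum_(s < i.+1) hk (i.+1.*2 + s.*2) 0 <= _); last first.
  suff : \sum_(s < i.+1) hk (i.+1.*2 + s.*2) 0 <=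
     \sum_(s < i.+1 + (M - i.+1)) hk (i.+1.*2 + s.*2) 0 :> R by rewrite subnKC.
  by rewrite big_split_ord /= lerDl; apply: sumr_ge0 => s _; exact: hk_ge0.
have C0 := return_cst_gt0 R.
apply: le_trans (_ : \sum_(s < i.+1) (return_cst * (2 * i.+1%:R) ^+ 2)^-1 <= _).
  rewrite big_const iter_addr_0 card_ord -[_ *+ i.+1]mulr_natl natr1.
  by rewrite le_eqVlt; apply/orP; left; apply/eqP; field; rewrite !gt_eqF.
apply: ler_sum => s _; rewrite -doubleD; apply: le_trans (hk_lower R _ _); last by rewrite addSn.
rewrite lef_pV2 ?posrE ?mulr_gt0 ?exprn_gt0 ?ltr0n ?addSn // ?mulr_gt0 //.
rewrite ler_wpM2l ?(ltW C0) // ler_sqr ?nnegrE ?mulr_ge0 // -natrM ler_nat.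
by have := ltn_ord s; lia.
Qed.

(** Chebyshev: standard deviation of order sqrt (log r) against a mean of
    order log r. *)
Lemma self_potential_low (R : realFieldType) M r : (0 < r)%N -> (r <= M)%N ->
  Ex r.*2 (fun s => (self_potential M r s < mean_self_potential M r / 2 :> R)%R%:R)
  <= 96%:R * heat_cst ^+ 2 * (4%:R * return_cst) ^+ 2 / harm r :> R.
Proof.
move=> r0 rM; set u : R := mean_self_potential M r.
have h1 : 1 <= harm r :> R by exact: harm_ge1.
have h0 : 0 < harm r :> R by exact: lt_le_trans h1.
have C0 := return_cst_gt0 R.
have hu : harm r / (4%:R * return_cst) <= u by exact: mean_self_potential_ge.
have u0 : 0 < u by apply: lt_le_trans hu; rewrite divr_gt0 ?mulr_gt0.
have V : Ex r.*2 (fun s => (self_potential M r s - u) ^+ 2) <= 24%:R * heat_cst ^+ 2 * harm r.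
  by rewrite Ex_sqr Ex_self_potential -/u; have := self_potential_sqr R M r; rewrite -/u; lra.
apply: le_trans (_ : Ex r.*2 (fun s => (self_potential M r s - u) ^+ 2 * (4%:R / u ^+ 2)) <= _).
  apply: Ex_le => s _; case: ltP => H /=; last by rewrite mulr_ge0 ?sqr_ge0 ?divr_ge0 ?sqr_ge0.
  rewrite mulrA ler_pdivlMr ?exprn_gt0 // mul1r.
  have k1 : 0 <= u / 2 - self_potential M r s by lra.
  have k2 : 0 <= 3%:R / 2 * u - self_potential M r s by lra.
  by have := mulr_ge0 k1 k2; nra.
rewrite ExZr; apply: le_trans (_ : (24%:R * heat_cst ^+ 2 * harm r) * (4%:R / u ^+ 2) <= _).
  by rewrite ler_wpM2r // divr_ge0 ?sqr_ge0.
apply: le_trans (_ : (24%:R * heat_cst ^+ 2 * harm r) * (4%:R / (harm r / (4%:R * return_cst)) ^+ 2) <= _).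
  rewrite ler_wpM2l ?mulr_ge0 ?sqr_ge0 ?(ltW h0) // ler_wpM2l // lef_pV2 ?posrE ?exprn_gt0 ?divr_gt0 ?mulr_gt0 //.
  by rewrite ler_sqr ?nnegrE ?(ltW u0) // divr_ge0 ?mulr_ge0 ?(ltW h0) ?(ltW C0).
by rewrite le_eqVlt; apply/orP; left; apply/eqP; field; rewrite !gt_eqF.
Qed.

(** * The mean capacity is at most of order n / log n *)

Lemma pos_take_diff k m s : pos (take (k + m) s) - pos (take k s) = pos (take m (drop k s)).
Proof. by rewrite takeD pos_cat addrC addKr. Qed.

(** Let D(y) be the potential at y of the occupation measure. The sum of e(y)
    D(y) is at most n + 1, so the points with D(y) >= c carry capacity at
    most (n+1)/c. The other points are counted by visit times; D at X_k
    dominates the self-potential of the walk started at time k, except for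
    the last 2r times where there is no room for it. *)
Lemma walkcap_upper (R : realType) M r (c : R) s : 0 < c -> (r.*2 <= size s)%N ->
  walkcap s <= (size s).+1%:R / c
    + \sum_(k < (size s).+1 - r.*2) (self_potential M r (take r.*2 (drop k s)) < c :> R)%R%:R + r.*2%:R.
Proof.
move=> c0 rs; set n := size s; set A := traj 0 s.
pose D (y : 'rV[int]_4) : R := \sum_(x <- A) green M.*2 (y - x).
have D0 y : 0 <= D y by apply: sumr_ge0 => x _; exact: green_ge0.
apply: le_trans (_ : \sum_(y <- undup A) (c^-1 * (esc A y * D y) + (D y < c :> R)%R%:R) <= _).
  apply: ler_sum => y _; case: ltP => Dc.
    apply: le_trans (esc_le1 _ _ _) _; rewrite lerDr mulr_ge0 ?invr_ge0 ?(ltW c0) //.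
    by rewrite mulr_ge0 ?esc_ge0.
  by rewrite addr0 mulrCA ler_peMr ?esc_ge0 // ler_pdivlMl // mulr1.
rewrite big_split /= -mulr_sumr -addrA; apply: lerD.
  rewrite mulrC ler_wpM2r ?invr_ge0 ?(ltW c0) //.
  under eq_bigr => y _ do rewrite mulr_sumr.
  rewrite exchange_big /=.
  apply: le_trans (_ : \sum_(x <- A) (1 : R) <= _).
    apply: ler_sum => x _; apply: le_trans (potential_le1 R A M.*2 x).
    by apply: ler_sum => y _; rewrite mulrC.
  by rewrite big_const_seq count_predT iter_addr_0 size_traj.
apply: le_trans (sum_undup_le _ _ _ _) _; first by move=> y; rewrite ler0n.
rewrite sum_traj -/n.
suff : \sum_(k < (n.+1 - r.*2) + r.*2) (D (0 + pos (take k s)) < c :> R)%R%:R <=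
   \sum_(k < n.+1 - r.*2) (self_potential M r (take r.*2 (drop k s)) < c :> R)%R%:R + r.*2%:R :> R.
  by rewrite subnK // leqW.
rewrite big_split_ord /=; apply: lerD; last first.
  apply: le_trans (_ : \sum_(i < r.*2) (1 : R) <= _).
    by apply: ler_sum => i _; case: ltP.
  by rewrite big_const iter_addr_0 card_ord.
apply: ler_sum => k _; have kn : (k + r.*2 <= n)%N by have := ltn_ord k; lia.
suff H : self_potential M r (take r.*2 (drop k s)) <= D (0 + pos (take k s)).
  by rewrite ler_nat; case: (ltP (D _) c) => // /(le_lt_trans H) ->.
rewrite /D sum_traj -/n add0r.
have e : n.+1 = (k.+1 + (r.*2 + (n - k - r.*2)))%N by lia.
pose F j : R := green M.*2 (pos (take k s) - (0 + pos (take j s))).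
have F0 j : 0 <= F j by exact: green_ge0.
suff : self_potential M r (take r.*2 (drop k s)) <= \sum_(j < k.+1 + (r.*2 + (n - k - r.*2))) F j.
  by rewrite -e.
rewrite big_split_ord /= ler_wpDl ?sumr_ge0 // big_split_ord /= ler_wpDr ?sumr_ge0 //.
rewrite (sum_pairs R (fun j => F (k.+1 + j)%N)); apply: ler_sum => i _.
rewrite ler_wpDl //; apply: le_trans (green_even_le_green _ _ _) _.
rewrite /F -[leRHS]greenN opprB add0r take_takel; last by rewrite leq_double; exact: ltn_ord.
by rewrite (_ : k.+1 + i.*2.+1 = k + i.+1.*2)%N ?pos_take_diff //; lia.
Qed.

Definition window_cst {R : realFieldType} : R :=
  8%:R * return_cst + 96%:R * heat_cst ^+ 2 * (4%:R * return_cst) ^+ 2.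

Lemma window_cst_gt0 (R : realFieldType) : 0 < window_cst :> R.
Proof.
by rewrite /window_cst addr_gt0 ?mulr_gt0 ?exprn_gt0 ?mulr_gt0 ?return_cst_gt0 ?heat_cst_gt0.
Qed.

(** In [walkcap_upper] take for c half of the mean self-potential, of order
    log r; a point is exceptional with probability O(1 / log r). *)
Lemma mean_cap_le_window (R : realType) r n : (0 < r)%N -> (r.*2 <= n)%N ->
  mean_cap n <= n.+1%:R * (window_cst / harm r) + r.*2%:R :> R.
Proof.
move=> r0 rn; have C0 := return_cst_gt0 R.
have h0 : 0 < harm r :> R by exact: lt_le_trans (harm_ge1 _ _ r0).
pose c : R := mean_self_potential r r / 2.
have hu : harm r / (4%:R * return_cst) <= mean_self_potential r r :> R by exact: mean_self_potential_ge.
have u0 : 0 < mean_self_potential r r :> R by apply: lt_le_trans hu; rewrite divr_gt0 ?mulr_gt0.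
have c0 : 0 < c by rewrite divr_gt0.
apply: le_trans (_ : Ex n (fun s => n.+1%:R / c
  + \sum_(k < n.+1 - r.*2) (self_potential r r (take r.*2 (drop k s)) < c :> R)%R%:R + r.*2%:R) <= _).
  by apply: Ex_le => s ss; have := walkcap_upper R r r c s c0; rewrite ss; apply.
rewrite !ExD !Ex_cst Ex_sum lerD2r.
rewrite /window_cst mulrDl mulrDr; apply: lerD.
  rewrite ler_wpM2l //.
  have -> : 8%:R * return_cst / harm r = ((harm r / (4%:R * return_cst)) / 2)^-1 :> R.
    by field; rewrite !gt_eqF.
  rewrite lef_pV2 ?posrE ?divr_gt0 ?mulr_gt0 //.
  by rewrite /c ler_wpM2r.
have P := self_potential_low R r r r0 (leqnn r).
apply: le_trans (_ : \sum_(k < n.+1 - r.*2) (96%:R * heat_cst ^+ 2 * (4%:R * return_cst) ^+ 2 / harm r : R) <= _).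
  apply: ler_sum => k _; apply: le_trans P.
  have kn : (k + r.*2 <= n)%N by have := ltn_ord k; lia.
  rewrite (Ex_drop R k n (fun s => (self_potential r r (take r.*2 s) < c :> R)%R%:R)); last by lia.
  by rewrite (Ex_take R r.*2 _ (fun s => (self_potential r r s < c :> R)%R%:R)) //; lia.
rewrite big_const iter_addr_0 card_ord -[(_ / harm r) *+ _]mulr_natl ler_wpM2r //.
  by rewrite divr_ge0 ?(ltW h0) // ?mulr_ge0 ?sqr_ge0.
by rewrite ler_nat leq_subr.
Qed.

Global Opaque window_cst.

(** * Local decomposition of the capacity by last visits *)

(** The contribution to the capacity of the point occupied at time i, counted
    only if i is the time of its last visit. *)
Definition last_visit {R : realType} (i : nat) (s : seq step) : R :=
  (pos (take i s) \notin drop i.+1 (traj 0 s))%:R * esc (traj 0 s) (pos (take i s)).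

Lemma last_visit_ge0 (R : realType) i s : 0 <= last_visit i s :> R.
Proof. by rewrite mulr_ge0 ?esc_ge0. Qed.

Lemma sum_undup_last (R : realFieldType) (A : seq 'rV[int]_4) (f : 'rV[int]_4 -> R) :
  \sum_(y <- undup A) f y
  = \sum_(k < size A) (nth 0 A k \notin drop k.+1 A)%:R * f (nth 0 A k).
Proof.
elim: A => [|a A IH]; first by rewrite big_nil big_ord0.
rewrite big_ord_recl /= drop0 -[\sum_(i < size A) _]IH.
by case: ifP => aA; rewrite ?big_cons ?mul0r ?add0r ?mul1r.
Qed.

Lemma sum_undup_traj (R : realType) z s (f : 'rV[int]_4 -> R) :
  \sum_(y <- undup (traj z s)) esc (traj z s) y * f y
  = \sum_(k < (size s).+1) last_visit k s * f (z + pos (take k s)).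
Proof.
rewrite sum_undup_last size_traj; apply: eq_bigr => k _.
have ks : (k <= size s)%N by rewrite -ltnS.
have -> : traj z s = [seq z + y | y <- traj 0 s] by rewrite -traj_shift addr0.
rewrite (nth_map 0) ?size_traj // nth_traj // add0r esc_shift /last_visit mulrA -map_drop.
by rewrite mem_map //; exact: addrI.
Qed.

Lemma walkcap_last_visit (R : realType) s : walkcap s = \sum_(k < (size s).+1) last_visit k s :> R.
Proof.
transitivity (\sum_(y <- undup (traj 0 s)) esc (traj 0 s) y * 1 : R).
  by apply: eq_bigr => y _; rewrite mulr1.
by rewrite sum_undup_traj; apply: eq_bigr => k _; rewrite mulr1.
Qed.

Lemma traj_cat_take x s t : traj x (s ++ t) = take (size s) (traj x s) ++ traj (x + pos s) t.
Proof.
elim: s x => [|e s IH] x; first by rewrite /= pos_nil addr0.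
by rewrite /= IH pos_cons addrA.
Qed.

Lemma traj_cat_drop x s t : traj x (s ++ t) = traj x s ++ drop 1 (traj (x + pos s) t).
Proof.
elim: s x => [|e s IH] x; last by rewrite /= IH pos_cons addrA.
by rewrite /= pos_nil addr0; case: t => [|e t] //=; rewrite drop0.
Qed.

Lemma last_visit_catr (R : realType) i s t : (i <= size s)%N ->
  last_visit i (s ++ t) <= last_visit i s :> R.
Proof.
move=> is_; rewrite /last_visit take_cat.
have -> : (if (i < size s)%N then take i s else s ++ take (i - size s) t) = take i s.
  case: ltnP => // si; have -> : i = size s by apply/eqP; rewrite eqn_leq is_.
  by rewrite subnn take0 cats0 take_size.
rewrite traj_cat_drop drop_cat size_traj ltnS.
apply: ler_pM; rewrite ?esc_ge0 ?ler0n //.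
  rewrite ler_nat; case: ltnP => si.
    by rewrite mem_cat negb_or; do 2 case: (_ \in _).
  have -> : i = size s by apply/eqP; rewrite eqn_leq is_.
  by rewrite (@drop_oversize _ (size s).+1 (traj 0 s)) ?size_traj // in_nil leq_b1.
by apply: esc_sub => y yA; rewrite mem_cat yA.
Qed.

Lemma last_visit_catl (R : realType) i s t : last_visit (size s + i) (s ++ t) <= last_visit i t :> R.
Proof.
rewrite /last_visit takeD take_size_cat // drop_size_cat // pos_cat.
rewrite traj_cat_take add0r -[(size s + i).+1]addnS drop_cat.
rewrite size_takel ?size_traj // ltnNge leq_addr /= addKn.
have E : traj (pos s) t = [seq pos s + y | y <- traj 0 t] by rewrite -traj_shift addr0.
rewrite [in X in _ * esc X _]E.
apply: ler_pM; rewrite ?esc_ge0 ?ler0n //.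
  by rewrite E -map_drop mem_map //; exact: addrI.
rewrite -(esc_shift R (traj 0 t) (pos s)).
by apply: esc_sub => y yA; rewrite mem_cat yA orbT.
Qed.

(** Forgetting what happens outside a window can only increase the
    contribution: fewer later visits are forbidden and a smaller set has to
    be avoided. *)
Lemma last_visit_window (R : realType) i l j s : (i <= l)%N -> (j + l <= size s)%N ->
  last_visit (j + i) s <= last_visit i (take l (drop j s)) :> R.
Proof.
move=> il jl; rewrite -{1}(cat_take_drop j s).
have sj : size (take j s) = j by rewrite size_takel //; lia.
rewrite -{1}sj; apply: le_trans (last_visit_catl _ _ _ _) _.
rewrite -{1}(cat_take_drop l (drop j s)); apply: last_visit_catr.
by rewrite size_takel // size_drop; lia.
Qed.

(** The mean contribution of the middle time of a walk of length 2l. *)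
Definition local_escape {R : realType} (l : nat) : R := Ex l.*2 (last_visit l).

Lemma local_escape_ge0 (R : realType) l : 0 <= local_escape l :> R.
Proof. by apply: Ex_ge0 => s _; exact: last_visit_ge0. Qed.

(** Each of the l + 1 times of a walk of length l is the middle of a window
    of length 2l, whose contribution is smaller. *)
Lemma local_escape_le (R : realType) l : local_escape l * l.+1%:R <= mean_cap l :> R.
Proof.
have -> : mean_cap l = \sum_(k < l.+1) Ex l (last_visit k) :> R.
  by rewrite /mean_cap -Ex_sum; apply: Ex_ext => s ss; rewrite walkcap_last_visit ss.
have -> : local_escape l * l.+1%:R = \sum_(k < l.+1) local_escape l :> R.
  by rewrite big_const iter_addr_0 card_ord mulr_natr.
apply: ler_sum => k _; have kl : (k <= l)%N by rewrite -ltnS.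
rewrite -(Ex_take R l (l.*2 - (l - k)) (last_visit k)); last by lia.
rewrite -(Ex_drop R (l - k) l.*2 (fun s => last_visit k (take l s))); last by lia.
apply: Ex_le => s ss; have := last_visit_window R k l (l - k) s kl.
by rewrite subnK //; apply; rewrite ss; lia.
Qed.

(** * Near additivity of the mean capacity *)

Lemma energy_pot (R : realType) M A z s :
  energy M A (traj z s) = \sum_(k < (size s).+1) last_visit k s *
    (\sum_(x <- undup A) esc A x * green M (z + pos (take k s) - x)) :> R.
Proof.
rewrite -(sum_undup_traj R z s (fun y => \sum_(x <- undup A) esc A x * green M (y - x))).
rewrite /energy exchange_big; apply: eq_bigr => y _; rewrite mulr_sumr.
by apply: eq_bigr => x _; rewrite mulrC.
Qed.

(** The times of the second walk s are cut into a beginning of 2L + 1 times,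
    a middle of m times and an end of L + 1 times. At the beginning and at
    the end the potential of A is bounded by 1, which leaves the capacity of
    a short walk. In the middle each contribution is bounded by that of the
    window of radius L around it. *)
Lemma energy_le (R : realType) M A z s L m : size s = (L.*2.+1 + (m + L))%N ->
  energy M A (traj z s) <= walkcap (take L.*2 s) + walkcap (drop (L.*2.+1 + m) s)
   + \sum_(k < m) \sum_(x <- undup A) esc A x *
       (green M (z + pos (take (L.*2.+1 + k) s) - x) * last_visit L (take L.*2 (drop (L.+1 + k) s))) :> R.
Proof.
move=> ss; rewrite energy_pot.
pose pot k : R := \sum_(x <- undup A) esc A x * green M (z + pos (take k s) - x).
have pot0 k : 0 <= pot k by apply: sumr_ge0 => x _; rewrite mulr_ge0 ?esc_ge0 ?green_ge0.
have pot1 k : pot k <= 1.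
  apply: le_trans (potential_le1 R A M (z + pos (take k s))); apply: ler_sum => x _.
  by rewrite mulrC -greenN opprB.
suff : \sum_(k < L.*2.+1 + (m + L.+1)) last_visit k s * pot k <= walkcap (take L.*2 s)
   + walkcap (drop (L.*2.+1 + m) s)
   + \sum_(k < m) \sum_(x <- undup A) esc A x *
       (green M (z + pos (take (L.*2.+1 + k) s) - x) * last_visit L (take L.*2 (drop (L.+1 + k) s))).
  by rewrite ss -!addnS.
rewrite !big_split_ord /= -addrA [X in _ <= _ + X]addrC; apply: lerD; last apply: lerD.
- rewrite walkcap_last_visit size_takel; last by rewrite ss; lia.
  apply: ler_sum => k _; apply: le_trans (_ : last_visit k s * 1 <= _).
    by rewrite ler_wpM2l ?last_visit_ge0.
  rewrite mulr1 -{1}[k : nat]add0n -[in leRHS](drop0 s).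
  by apply: last_visit_window; [rewrite -ltnS | rewrite ss; lia].
- apply: ler_sum => k _; rewrite /pot mulr_sumr; apply: ler_sum => x _.
  rewrite mulrCA; apply: ler_wpM2l; first exact: esc_ge0.
  rewrite mulrC; apply: ler_wpM2l; first exact: green_ge0.
  have -> : (L.*2.+1 + k = (L.+1 + k) + L)%N by lia.
  by apply: last_visit_window; [lia | rewrite ss; have := ltn_ord k; lia].
- have sd : size (drop (L.*2.+1 + m) s) = L by rewrite size_drop ss; lia.
  rewrite walkcap_last_visit sd; apply: ler_sum => k _.
  apply: le_trans (_ : last_visit (L.*2.+1 + (m + k)) s * 1 <= _).
    by rewrite ler_wpM2l ?last_visit_ge0.
  rewrite mulr1 addnA -[drop _ s in leRHS](@take_size _ (drop (L.*2.+1 + m) s)) sd.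
  by apply: last_visit_window; [rewrite -ltnS | rewrite ss; lia].
Qed.

(** Given the window, the increments before it are independent and average
    the Green function down to O(1/L), wherever it is centred. *)
Lemma Ex_green_window (R : realType) M L k b c : (L <= k)%N -> (k + L.*2 <= b)%N ->
  Ex b (fun s => green M (c + pos (take (k + L) s)) * last_visit L (take L.*2 (drop k s)))
  <= (2 * heat_cst) / L.+1%:R * local_escape L :> R.
Proof.
move=> Lk kb; have kb' : (k <= b)%N by lia.
have -> : Ex b (fun s => green M (c + pos (take (k + L) s)) * last_visit L (take L.*2 (drop k s)))
  = Ex b (fun s => green M (c + (pos (take k s) + pos (take L (drop k s))))
      * last_visit L (take L.*2 (drop k s))) :> R.
  by apply: Ex_ext => s _; rewrite takeD pos_cat.
rewrite (Ex_split R k b (fun u v => green M (c + (pos u + pos (take L v))) * last_visit L (take L.*2 v))) //.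
rewrite Ex_swap /local_escape -(Ex_take R L.*2 (b - k)); last by lia.
rewrite -ExZ; apply: Ex_le => v _.
rewrite ExZr ler_wpM2r ?last_visit_ge0 //.
apply: le_trans (_ : (2 * heat_cst) / (k%:R + 1) <= _); last first.
  by rewrite -[L.+1%:R]natr1; exact: tail_anti.
apply: le_trans (hk_tail R k M (c + pos (take L v))); rewrite -Ex_green.
by apply: Ex_le => u _; rewrite [pos u + _]addrC addrA.
Qed.

Lemma Ex_energy_le (R : realType) M A z L m :
  Ex (L.*2.+1 + (m + L)) (fun s => energy M A (traj z s))
  <= mean_cap L.*2 + mean_cap L + cap A * (m%:R * ((2 * heat_cst) / L.+1%:R * local_escape L)) :> R.
Proof.
set b := (L.*2.+1 + (m + L))%N.
apply: le_trans (Ex_le _ _ _ _ (fun s ss => energy_le R M A z s L m ss)) _.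
rewrite !ExD -/b; apply: lerD; first apply: lerD.
- by rewrite (Ex_take R L.*2 b walkcap) // /b; lia.
- have e : (b - (L.*2.+1 + m) = L)%N by rewrite /b; lia.
  by rewrite (Ex_drop R (L.*2.+1 + m) b walkcap) ?e // /b; lia.
rewrite Ex_sum; set q : R := (_ / _) * local_escape L.
have -> : cap A * (m%:R * q) = \sum_(k < m) \sum_(x <- undup A) esc A x * q :> R.
  by rewrite big_const iter_addr_0 card_ord -mulr_suml -/(cap A) -[(_ * q) *+ m]mulr_natl mulrCA.
apply: ler_sum => k _; rewrite Ex_sum; apply: ler_sum => x _; rewrite ExZ.
rewrite ler_wpM2l ?esc_ge0 //.
have e : (L.*2.+1 + k = (L.+1 + k) + L)%N by lia.
rewrite e; apply: le_trans (Ex_green_window R M L (L.+1 + k) b (z - x) _ _).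
- by apply: Ex_le => s _; rewrite addrAC.
- by lia.
- by rewrite /b; have := ltn_ord k; lia.
Qed.

Lemma le_add_vanishing (R : realType) (x y c : R) :
  (forall M : nat, x <= y + c / (M%:R + 1)) -> x <= y.
Proof.
move=> H; rewrite leNgt; apply/negP => yx.
have d0 : 0 < x - y by rewrite subr_gt0.
pose N := Num.bound (`|c| / (x - y)).
have NP : `|c| / (x - y) < N%:R.
  by rewrite archi_boundP // divr_ge0 ?normr_ge0 // ltW.
have h := H N; have N1 : 0 < N%:R + 1 :> R by rewrite ltr_wpDl.
have : `|c| < N%:R * (x - y) by rewrite -ltr_pdivrMr.
have : x - y <= c / (N%:R + 1) by rewrite lerBlDl.
rewrite ler_pdivlMr // => h1 h2; have := ler_norm c.
nra.
Qed.

(** [cap_energy] for the two halves of the walk, averaged over the second one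
    by [Ex_energy_le] for a fixed first one. *)
Lemma mean_cap_almost_additive (R : realType) a L m (b := (L.*2.+1 + (m + L))%N) :
  mean_cap a + mean_cap b - mean_cap (a + b)
  <= 2 * (mean_cap L.*2 + mean_cap L
          + mean_cap a * (m%:R * ((2 * heat_cst) / L.+1%:R * local_escape L))) :> R.
Proof.
apply: (@le_add_vanishing R _ _ ((a.+1 + b.+1)%:R ^+ 2 * (2 * heat_cst))) => M.
rewrite lerBlDl.
set q : R := m%:R * _.
apply: le_trans (_ : Ex a (fun s => walkcap s + mean_cap b) <= _).
  by rewrite ExD Ex_cst.
rewrite {2}/mean_cap Ex_cat -(Ex_cst R a ((a.+1 + b.+1)%:R ^+ 2 * (2 * heat_cst) / (M%:R + 1))).
rewrite -ExZr -(Ex_cst R a (mean_cap L.*2 + mean_cap L)) -ExD -ExZ -!ExD.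
apply: Ex_le => s ss.
apply: le_trans (_ : Ex b (fun t => walkcap s + walkcap t) <= _).
  by rewrite ExD Ex_cst.
apply: le_trans (_ : Ex b (fun t => walkcap (s ++ t) + (2 * energy M (traj 0 s) (traj (pos s) t)
   + (a.+1 + b.+1)%:R ^+ 2 * (2 * heat_cst) / (M%:R + 1))) <= _).
  apply: Ex_le => t tt; have := cap_energy R M (traj 0 s) (traj (pos s) t).
  have -> : cap (traj 0 s ++ traj (pos s) t) = walkcap (s ++ t) :> R.
    by rewrite /walkcap (cap_eq_mem _ _ _ (traj_cat 0 s t)) add0r.
  by rewrite !cap_traj !size_traj ss tt -!addrA !mulrA.
rewrite ExD lerD2l ExD Ex_cst lerD2r ExZ ler_wpM2l //.
exact: Ex_energy_le.
Qed.

(** * Two-sided bounds of the mean capacity *)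

(** Cut the sum into blocks of length a: the first block is harm a, and the
    q-th block after it is at most 1/q. *)
Lemma harm_mul (R : realFieldType) a b : harm (a * b.+1) <= harm a + harm b :> R.
Proof.
case: a => [|a]; first by rewrite mul0n /harm !big_ord0 add0r; exact: harm_ge0.
elim: b => [|b IH]; first by rewrite muln1 lerDl harm_ge0.
have -> : harm (a.+1 * b.+2) = harm (a.+1 * b.+1)
    + \sum_(i < a.+1) ((a.+1 * b.+1 + i)%:R + 1)^-1 :> R.
  by rewrite mulnS addnC /harm big_split_ord.
have -> : harm b.+1 = harm b + (b%:R + 1)^-1 :> R by rewrite /harm big_ord_recr.
rewrite addrA; apply: lerD => //.
apply: le_trans (_ : \sum_(i < a.+1) (a.+1%:R * (b%:R + 1))^-1 <= _).
  apply: ler_sum => i _; rewrite lef_pV2 ?posrE ?mulr_gt0 ?ltr_wpDl ?ltr0n //.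
  by rewrite natr1 -natrM natr1 ler_nat -addnS leq_addr.
rewrite big_const iter_addr_0 card_ord -[(_^-1) *+ _]mulr_natl invfM mulrA mulfV ?mul1r // pnatr_eq0.
Qed.

Lemma harm_unbounded (R : realType) (K : R) : exists n, K <= harm n.
Proof.
have D n : harm n.+1 + 1 / 2 <= harm (n.+1 + n.+1) :> R.
  rewrite {2}/harm big_split_ord lerD2l.
  apply: le_trans (_ : \sum_(i < n.+1) (2 * n.+1%:R)^-1 <= _).
    rewrite big_const iter_addr_0 card_ord -[(_^-1) *+ _]mulr_natl.
    rewrite le_eqVlt; apply/orP; left; apply/eqP; field.
    by rewrite gt_eqF // ?ltr_wpDl ?ltr_wpDr.
  apply: ler_sum => i _; rewrite lef_pV2 ?posrE ?mulr_gt0 ?ltr_wpDl ?ltr0n //=.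
  by rewrite natr1 -natrM ler_nat; have := ltn_ord i; lia.
have E j : exists n, j%:R / 2 <= harm n.+1 :> R.
  elim: j => [|j [n IH]]; first by exists 0%N; rewrite mul0r harm_ge0.
  exists (n + n.+1)%N; rewrite -addSn; apply: le_trans (D n).
  by rewrite -natr1 mulrDl lerD2r.
have [n Hn] := E (Num.bound (2 * `|K|)).
exists n.+1; apply: le_trans Hn; rewrite ler_pdivlMr // mulrC.
apply: le_trans (ltW (archi_boundP _)); first by rewrite ler_wpM2l // ler_norm.
by rewrite mulr_ge0.
Qed.

Lemma harm_le_nat (R : realFieldType) n : harm n <= n%:R :> R.
Proof.
apply: le_trans (_ : \sum_(i < n) (1 : R) <= _).
  by apply: ler_sum => i _; rewrite invf_le1 ?ltr_wpDl // lerDr.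
by rewrite big_const iter_addr_0 card_ord.
Qed.

Definition cap_hi_cst {R : realFieldType} : R := 3%:R * (window_cst + 2).

Lemma cap_hi_cst_ge6 (R : realFieldType) : 6%:R <= cap_hi_cst :> R.
Proof. by rewrite /cap_hi_cst; have := window_cst_gt0 R; lra. Qed.

Lemma harmS_gt0 (R : realFieldType) n : 0 < harm n.+1 :> R.
Proof. by apply: lt_le_trans (harm_ge1 _ _ _). Qed.

Lemma mean_cap_le_size (R : realType) n : mean_cap n <= n.+1%:R :> R.
Proof.
rewrite -(Ex_cst R n n.+1%:R); apply: Ex_le => s ss.
by apply: le_trans (walkcap_le _ _) _; rewrite ss.
Qed.

(** [mean_cap_le_window] with r the integer square root of n, for which log r
    is comparable to log n. *)
Lemma mean_cap_le (R : realType) n : mean_cap n <= n.+1%:R * (cap_hi_cst / harm n.+1) :> R.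
Proof.
have h0 := harmS_gt0 R n; have K6 := cap_hi_cst_ge6 R; have U0 := window_cst_gt0 R.
(* For n < 4 the square root of n would be too small, but m_n <= n + 1 suffices. *)
case: (ltnP n 4) => n4.
  apply: le_trans (mean_cap_le_size _ _) _; rewrite ler_peMr // ler_pdivlMr // mul1r.
  apply: le_trans (harm_le_nat _ _) _; apply: le_trans K6.
  by rewrite ler_nat; lia.
have [r /andP[r1 r2]] := nat_sqrtP n.
have r3 : (1 < r)%N by case: r r1 r2 => [|[|r]]; rewrite -?mulnn; lia.
have rn : (r.*2 <= n)%N by apply: leq_trans r1; rewrite -mulnn -muln2 leq_mul.
have hr0 : 0 < harm r :> R by apply: lt_le_trans (harm_ge1 _ _ (ltnW r3)).
have hr1 : 1 <= harm r :> R by apply: harm_ge1; exact: ltnW.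
have H : harm n.+1 <= 3%:R * harm r :> R.
  apply: le_trans (harm_le R _ _ r2) _; rewrite -mulnn.
  apply: le_trans (harm_mul _ _ _) _; 
  have -> : harm r.+1 = harm r + (r%:R + 1)^-1 :> R by rewrite /harm big_ord_recr.
  have : (r%:R + 1)^-1 <= 1 :> R by rewrite invf_le1 ?ltr_wpDl // lerDr.
  lra.
apply: le_trans (mean_cap_le_window R r n (ltnW r3) rn) _.
apply: le_trans (_ : n.+1%:R * ((window_cst + 2) / harm r) <= _).
  rewrite [in leRHS]mulrDl [leRHS]mulrDr lerD2l mulrA ler_pdivlMr //.
  apply: le_trans (_ : r.*2%:R * r%:R <= _); first by rewrite ler_wpM2l // harm_le_nat.
  by rewrite -!natrM ler_nat -muln2 -mulnA [(2 * r)%N]mulnC mulnA mulnn leq_mul2r (leq_trans r1).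
rewrite ler_wpM2l // ler_pdivrMr // mulrAC ler_pdivlMr // /cap_hi_cst.
have : (window_cst + 2) * harm n.+1 <= (window_cst + 2) * (3%:R * harm r) :> R by rewrite ler_wpM2l //; lra.
lra.
Qed.

Global Opaque cap_hi_cst.

Lemma mean_cap_gt0 (R : realType) n : 0 < mean_cap n :> R.
Proof.
by apply: lt_le_trans (mean_cap_ge R n); rewrite divr_gt0 ?mulr_gt0 ?cap_lo_cst_gt0 ?harmS_gt0 ?ltr0n.
Qed.

Lemma local_escape_le_harm (R : realType) L : local_escape L <= cap_hi_cst / harm L.+1 :> R.
Proof.
rewrite -(@ler_pM2r _ L.+1%:R) ?ltr0n //; apply: le_trans (local_escape_le _ _) _.
by rewrite [leRHS]mulrC; exact: mean_cap_le.
Qed.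

(** In [mean_cap_almost_additive] take L = b / k with k a large constant. The
    short walks then have mean capacity O(1/k) times that of b, and the
    middle term is O(k / log L) times the mean capacity of a. *)
Lemma mean_cap_defect (R : realType) (eta : R) : 0 < eta ->
  exists N0, forall a b, (N0 <= b)%N ->
    mean_cap a + mean_cap b - mean_cap (a + b) <= eta * (mean_cap a + mean_cap b) :> R.
Proof.
move=> eta0; have Klo0 := cap_lo_cst_gt0 R; have C0 := heat_cst_gt0 R.
have Kup0 : 0 < cap_hi_cst :> R by apply: lt_le_trans (cap_hi_cst_ge6 R).
have p3 (x y z : R) : 0 < x -> 0 < y -> 0 < z -> 0 <= x * y * z.
  by move=> x0 y0 z0; rewrite ltW // !mulr_gt0.
have p4 (x y z t : R) : 0 < x -> 0 < y -> 0 < z -> 0 < t -> 0 <= x * y * z * t.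
  by move=> x0 y0 z0 t0; rewrite ltW // !mulr_gt0.
(* k makes the short walks contribute at most eta/2 of the mean capacity of b. *)
have [k [k4 kP]] : exists k : nat, (4 <= k)%N /\ 20%:R * cap_hi_cst * cap_lo_cst / k%:R <= eta.
  exists (Num.bound (20%:R * cap_hi_cst * cap_lo_cst / eta : R) + 4)%N; split; first exact: leq_addl.
  rewrite ler_pdivrMr; last by rewrite ltr0n addnS.
  rewrite -ler_pdivrMl // mulrC.
  apply: le_trans (_ : (Num.bound (20%:R * cap_hi_cst * cap_lo_cst / eta : R))%:R <= _).
    by rewrite ltW // archi_boundP // divr_ge0 ?(ltW eta0) // p3.
  by rewrite ler_nat leq_addr.
have kpos : (0 < k)%N by apply: leq_trans k4.
have k0 : 0 < k%:R :> R by rewrite ltr0n.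
(* Beyond L0, harm L exceeds both harm k, so that harm b <= 2 harm L, and the
   multiple of k / eta that makes the middle term at most eta/2. *)
have [L0 L0P] := harm_unbounded R (harm k + 4%:R * k%:R * heat_cst * cap_hi_cst / eta).
exists (k * L0.+1)%N => a b bN.
have [L [LL0 bL1 bL2]] : exists L, [/\ (L0 < L)%N, (L * k <= b)%N & (b < L.+1 * k)%N].
  by exists (b %/ k)%N; rewrite leq_divM ltn_ceil // leq_divRL // mulnC.
have [m mE] : exists m, b = (L.*2.+1 + (m + L))%N.
  exists (b - L.*2.+1 - L)%N.
  have : (4 * L <= b)%N by apply: leq_trans bL1; rewrite mulnC leq_mul2l k4 orbT.
  by clear -LL0; lia.
have HL0 := harmS_gt0 R L.
have HL : harm k + 4%:R * k%:R * heat_cst * cap_hi_cst / eta <= harm L.+1 :> R.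
  by apply: le_trans L0P (harm_le _ _ _ _); exact/ltnW/ltnW.
have pos1 : 0 <= 4%:R * k%:R * heat_cst * cap_hi_cst / eta by rewrite divr_ge0 ?(ltW eta0) // p4.
have hk0 : 0 <= harm k :> R by exact: harm_ge0.
have Hb : harm b.+1 <= 2 * harm L.+1 :> R.
  apply: le_trans (harm_le R _ _ bL2) _; have -> : k = k.-1.+1 by rewrite prednK.
  apply: le_trans (harm_mul _ _ _) _.
  have : harm k.-1 <= harm k :> R by apply: harm_le; exact: leq_pred.
  lra.
have mab := mean_cap_ge0 R a; have mb := mean_cap_ge0 R b.
have T1 : mean_cap L.*2 + mean_cap L <= 10%:R * cap_hi_cst * cap_lo_cst / k%:R * mean_cap b :> R.
  apply: le_trans (_ : 5%:R * L%:R * (cap_hi_cst / harm L.+1) <= _).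
    apply: le_trans (lerD (mean_cap_le _ _) (mean_cap_le _ _)) _.
    apply: le_trans (_ : L.*2.+1%:R * (cap_hi_cst / harm L.+1) + L.+1%:R * (cap_hi_cst / harm L.+1) <= _).
      rewrite lerD2r ler_wpM2l // ler_wpM2l ?(ltW Kup0) // lef_pV2 ?posrE ?harmS_gt0 //.
      by apply: harm_le; rewrite ltnS -addnn leq_addr.
    rewrite -mulrDl ler_wpM2r ?divr_ge0 ?(ltW Kup0) ?(ltW HL0) //.
    by rewrite -natrD -natrM ler_nat; clear -LL0; lia.
  have lb := mean_cap_ge R b.
  apply: le_trans (_ : 10%:R * cap_hi_cst * cap_lo_cst / k%:R * (b.+1%:R / (cap_lo_cst * (2 * harm L.+1))) <= _).
    have -> : 10%:R * cap_hi_cst * cap_lo_cst / k%:R * (b.+1%:R / (cap_lo_cst * (2 * harm L.+1))) =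
      5%:R * (b.+1%:R / k%:R) * (cap_hi_cst / harm L.+1) :> R by field; rewrite !gt_eqF.
    rewrite ler_wpM2r ?divr_ge0 ?(ltW Kup0) ?(ltW HL0) // ler_wpM2l // ler_pdivlMr //.
    by rewrite -natrM ler_nat leqW.
  rewrite ler_wpM2l; last apply: le_trans lb.
    by [].
    by rewrite divr_ge0 ?(ltW k0) // p3.
  rewrite ler_wpM2l // lef_pV2 ?posrE ?mulr_gt0 ?harmS_gt0 //.
  by rewrite ler_wpM2l // ltW.
have T2 : m%:R * ((2 * heat_cst) / L.+1%:R * local_escape L) <= eta / 2.
  apply: le_trans (_ : k%:R * (2 * heat_cst) * (cap_hi_cst / harm L.+1) <= _).
    have mk : m%:R / L.+1%:R <= k%:R :> R.
      rewrite ler_pdivrMr ?ltr0n // -natrM ler_nat mulnC.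
      by apply: leq_trans (ltnW bL2); rewrite mE; clear; lia.
    have -> : m%:R * ((2 * heat_cst) / L.+1%:R * local_escape L) = (m%:R / L.+1%:R) * (2 * heat_cst) * local_escape L :> R.
      by ring.
    have C2 := twice_heat_cst_ge0 R.
    apply: ler_pM; rewrite ?local_escape_ge0 ?local_escape_le_harm // ?mulr_ge0 ?divr_ge0 //.
    exact: ler_wpM2r.
  rewrite mulrA ler_pdivrMr //.
  have : eta / 2 * (4%:R * k%:R * heat_cst * cap_hi_cst / eta) <= eta / 2 * harm L.+1.
    by rewrite ler_wpM2l ?divr_ge0 ?(ltW eta0) //; lra.
  have -> : eta / 2 * (4%:R * k%:R * heat_cst * cap_hi_cst / eta) = k%:R * (2 * heat_cst) * cap_hi_cst.
    by field; rewrite gt_eqF.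
  by [].
have := mean_cap_almost_additive R a L m; rewrite -mE => /le_trans; apply.
have T1' : mean_cap L.*2 + mean_cap L <= eta / 2 * mean_cap b :> R.
  apply: le_trans T1 _; rewrite ler_wpM2r //.
  by move: kP; rewrite (_ : 20%:R * cap_hi_cst * cap_lo_cst / k%:R = 2 * (10%:R * cap_hi_cst * cap_lo_cst / k%:R)); [lra | ring].
have T2' := ler_wpM2l mab T2.
have -> : eta * (mean_cap a + mean_cap b) = 2 * (eta / 2 * mean_cap b + mean_cap a * (eta / 2)) :> R by field.
by rewrite ler_wpM2l // lerD.
Qed.

(** * Variance recursion *)

Definition var_cap {R : realType} (n : nat) : R :=
  Ex n (fun s => walkcap s ^+ 2) - mean_cap n ^+ 2.

Lemma var_capE (R : realType) n : var_cap n = Ex n (fun s => (walkcap s - mean_cap n) ^+ 2) :> R.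
Proof. by rewrite Ex_sqr -/(mean_cap n) /var_cap; ring. Qed.

Lemma var_cap_ge0 (R : realType) n : 0 <= var_cap n :> R.
Proof. by rewrite var_capE; apply: Ex_ge0 => s _; exact: sqr_ge0. Qed.

(** The capacity of the whole walk is at most the sum of those of its two
    independent parts, hence so are the second moments; the last two terms
    correct for the means. *)
Lemma var_cap_add (R : realType) a b :
  var_cap (a + b) <= var_cap a + var_cap b
    + ((mean_cap a + mean_cap b) ^+ 2 - mean_cap (a + b) ^+ 2) :> R.
Proof.
rewrite {1}/var_cap addrA lerD2r.
apply: le_trans (_ : Ex a (fun s => Ex b (fun t => (walkcap s + walkcap t) ^+ 2)) <= _).
  rewrite Ex_cat; apply: Ex_le => s _; apply: Ex_le => t _.
  by rewrite ler_sqr ?nnegrE ?addr_ge0 ?walkcap_ge0 // walkcap_cat.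
have -> : Ex a (fun s => Ex b (fun t => (walkcap s + walkcap t) ^+ 2)) =
   Ex a (fun s => walkcap s ^+ 2 + (walkcap s * (2 * mean_cap b) + Ex b (fun t => walkcap t ^+ 2))) :> R.
  apply: Ex_ext => s _; rewrite -[walkcap s ^+ 2 in RHS](Ex_cst R b) -!ExZ -!ExD.
  by apply: Ex_ext => t _; ring.
rewrite !ExD Ex_cst ExZr -/(mean_cap a) /var_cap le_eqVlt; apply/orP; left; apply/eqP; ring.
Qed.

(** From the two-sided bounds, since the harmonic numbers at a and at b
    differ by a factor of at most 2. *)
Lemma mean_cap_balanced (R : realType) a b : (a <= b <= a.+1)%N ->
  mean_cap a <= (2 * cap_hi_cst * cap_lo_cst) * mean_cap b :> R /\
  mean_cap b <= (2 * cap_hi_cst * cap_lo_cst) * mean_cap a :> R.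
Proof.
move=> /andP[ab ba].
have Klo0 := cap_lo_cst_gt0 R; have Kup0 : 0 < cap_hi_cst :> R by apply: lt_le_trans (cap_hi_cst_ge6 R).
have K0 : 0 < 2 * cap_hi_cst * cap_lo_cst :> R by exact: (mulr_gt0 (mulr_gt0 (ltr0Sn R 1) Kup0) Klo0).
have Ha := harmS_gt0 R a; have Hb := harmS_gt0 R b.
have hab : harm a.+1 <= harm b.+1 :> R by exact: harm_le.
have hba : harm b.+1 <= 2 * harm a.+1 :> R.
  apply: le_trans (harm_le R _ _ (_ : b.+1 <= a.+2)%N) _ => //.
  have -> : harm a.+2 = harm a.+1 + (a.+1%:R + 1)^-1 :> R by rewrite /harm big_ord_recr.
  have : (a.+1%:R + 1)^-1 <= 1 :> R by rewrite invf_le1 ?ltr_wpDl // lerDr.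
  by have := harm_ge1 R a.+1 isT; lra.
have step (x y : nat) : (x.+1 <= 2 * y.+1)%N -> harm y.+1 * x.+1%:R <= 2 * harm x.+1 * y.+1%:R :> R ->
    mean_cap x <= (2 * cap_hi_cst * cap_lo_cst) * mean_cap y :> R.
  move=> xy h; have Hx := harmS_gt0 R x; have Hy := harmS_gt0 R y.
  apply: le_trans (mean_cap_le R x) _.
  apply: le_trans (_ : (2 * cap_hi_cst * cap_lo_cst) * (y.+1%:R / (cap_lo_cst * harm y.+1)) <= _); last first.
    by rewrite ler_wpM2l ?mean_cap_ge // ltW.
  have -> : (2 * cap_hi_cst * cap_lo_cst) * (y.+1%:R / (cap_lo_cst * harm y.+1)) = cap_hi_cst * (2 * y.+1%:R / harm y.+1) :> R.
    by field; rewrite !gt_eqF.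
  rewrite mulrCA ler_wpM2l ?(ltW Kup0) // ler_pdivlMr // mulrAC ler_pdivrMr //.
  by rewrite mulrC; lra.
have na : 0 <= a.+1%:R :> R by [].
have nb : 0 <= b.+1%:R :> R by [].
have nab : a.+1%:R <= b.+1%:R :> R by rewrite ler_nat.
have h2 : (b.+1 <= 2 * a.+1)%N by clear -ba; lia.
have h3 : (a.+1 <= 2 * b.+1)%N by clear -ab; lia.
have nba : b.+1%:R <= 2 * a.+1%:R :> R by rewrite -natrM ler_nat.
split; apply: step => //.
  by have := ler_pM (ltW Hb) na hba nab; lra.
by have := ler_pM (ltW Ha) nb hab nba; lra.
Qed.

(** If both variance ratios are at most W, the variance of the whole is at
    most W (m_a^2 + m_b^2) plus an error that is negligible by near
    additivity. Because m_a and m_b are comparable, m_a^2 + m_b^2 is at most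
    (1 - g) (m_a + m_b)^2 for a fixed g > 0. *)
Lemma var_cap_ratio_step (R : realType) : exists rho : R, [/\ 0 <= rho, rho < 1 &
  forall eta : R, 0 < eta -> exists N0, forall n, (N0 <= n)%N ->
    var_cap n / mean_cap n ^+ 2 <= rho * Num.max (var_cap n./2 / mean_cap n./2 ^+ 2)
      (var_cap (n - n./2) / mean_cap (n - n./2) ^+ 2) + eta].
Proof.
have Klo0 := cap_lo_cst_gt0 R; have Kup0 : 0 < cap_hi_cst :> R by apply: lt_le_trans (cap_hi_cst_ge6 R).
pose K : R := 2 * cap_hi_cst * cap_lo_cst.
have K0 : 0 < K by exact: (mulr_gt0 (mulr_gt0 (ltr0Sn R 1) Kup0) Klo0).
have [g [g0 g1 gP]] : exists g : R, [/\ 0 < g, g < 1 & forall a b, (a <= b <= a.+1)%N ->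
    mean_cap a ^+ 2 + mean_cap b ^+ 2 <= (1 - g) * (mean_cap a + mean_cap b) ^+ 2].
  (* Both means are at least (m_a + m_b) / (1 + K). *)
  exists ((1 + K) ^- 2); split.
  - by rewrite invr_gt0 exprn_gt0 // addr_gt0.
  - by rewrite invf_lt1 ?exprn_gt0 ?addr_gt0 // exprn_egt1 // ltrDl.
  move=> a b ab; have [h1 h2] := mean_cap_balanced R a b ab.
  have ma := mean_cap_gt0 R a; have mb := mean_cap_gt0 R b; rewrite -/K in h1 h2.
  set x := mean_cap a in h1 h2 ma *; set y := mean_cap b in h1 h2 mb *.
  have hx : (x + y) / (1 + K) <= x.
    by rewrite ler_pdivrMr ?addr_gt0 // mulrDr mulr1 lerD2l mulrC.
  have hy : (x + y) / (1 + K) <= y.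
    by rewrite ler_pdivrMr ?addr_gt0 // mulrDr mulr1 addrC lerD2l mulrC.
  have s0 : 0 <= (x + y) / (1 + K) by rewrite divr_ge0 // ltW // addr_gt0.
  have := ler_pM s0 s0 hx hy; rewrite -expr2 expr_div_n => h.
  have xy0 : 0 <= x * y by rewrite mulr_ge0 // ltW.
  have -> : (1 - (1 + K) ^- 2) * (x + y) ^+ 2 = (x + y) ^+ 2 - (x + y) ^+ 2 / (1 + K) ^+ 2.
    by ring.
  lra.
exists (1 - g / 2); split; [lra | lra |] => eta eta0.
(* With this t, (1 - g) / (1 - t)^2 <= 1 - g/2 and 2 t / (1 - t)^2 <= eta. *)
pose t : R := Num.min (g / 8%:R) (eta / 8%:R).
have t0 : 0 < t by rewrite lt_min !divr_gt0.
have tg : t <= g / 8%:R by rewrite ge_min lexx.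
have te : t <= eta / 8%:R by rewrite ge_min lexx orbT.
have [N0 N0P] := mean_cap_defect R t t0.
exists N0.*2.+1 => n nN.
pose a := n./2; pose b := (n - n./2)%N; rewrite -/a -/b.
have ab : (a <= b <= a.+1)%N by rewrite /a /b; clear; lia.
have nE : n = (a + b)%N by rewrite /a /b; clear; lia.
have bN : (N0 <= b)%N by rewrite /b; clear -nN; lia.
have := N0P a b bN; rewrite {1 2}nE => D.
have := var_cap_add R a b; rewrite -nE in D * => V.
have G := gP a b ab.
have ma := mean_cap_gt0 R a; have mb := mean_cap_gt0 R b; have mn := mean_cap_gt0 R n.
set W := Num.max _ _.
have Wa : var_cap a <= W * mean_cap a ^+ 2 by rewrite -ler_pdivrMr ?exprn_gt0 // le_max lexx.
have Wb : var_cap b <= W * mean_cap b ^+ 2 by rewrite -ler_pdivrMr ?exprn_gt0 // le_max lexx orbT.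
have W0 : 0 <= W by rewrite le_max divr_ge0 ?var_cap_ge0 ?sqr_ge0.
rewrite ler_pdivrMr ?exprn_gt0 //.
set S := mean_cap a + mean_cap b in D V G *.
have S0 : 0 < S by rewrite addr_gt0.
have D' : (1 - t) * S <= mean_cap n by lra.
have t1 : t <= 1 / 8%:R by lra.
have D2 : (1 - 2 * t) * S ^+ 2 <= mean_cap n ^+ 2.
  apply: le_trans (_ : ((1 - t) * S) ^+ 2 <= _).
    rewrite exprMn ler_wpM2r ?sqr_ge0 //; have := sqr_ge0 t; nra.
  by rewrite ler_sqr ?nnegrE ?(ltW mn) // mulr_ge0 ?(ltW S0) //; lra.
have V2 : var_cap n <= W * ((1 - g) * S ^+ 2) + 2 * t * S ^+ 2.
  have := ler_wpM2l W0 G; rewrite mulrDr; lra.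
apply: le_trans V2 _; rewrite [leRHS]mulrDl; apply: lerD.
  rewrite -[leRHS]mulrA [leRHS]mulrCA ler_wpM2l //.
  apply: le_trans (_ : (1 - g / 2) * ((1 - 2 * t) * S ^+ 2) <= _); last first.
    by rewrite ler_wpM2l //; lra.
  rewrite [leRHS]mulrA ler_wpM2r ?sqr_ge0 //; nra.
apply: le_trans (_ : eta * ((1 - 2 * t) * S ^+ 2) <= _); last first.
  by rewrite ler_wpM2l // ltW.
rewrite [leRHS]mulrA ler_wpM2r ?sqr_ge0 //; nra.
Qed.

(** The recursion first yields boundedness, then a geometric decay along
    dyadic scales down to the size of the error. *)
Lemma halving_recursion (R : realType) (w : nat -> R) (rho : R) :
  0 <= rho -> rho < 1 -> (forall n, 0 <= w n) ->
  (forall eta : R, 0 < eta -> exists N0, forall n, (N0 <= n)%N ->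
    w n <= rho * Num.max (w n./2) (w (n - n./2)%N) + eta) ->
  w n @[n --> \oo] --> (0 : R).
Proof.
move=> rho0 rho1 w0 H; apply/cvgrPdist_le => eps eps0.
(* With this error, eps/2 is the fixed point of u = rho u + error. *)
have eta0 : 0 < eps * (1 - rho) / 2 by rewrite divr_gt0 ?mulr_gt0 ?subr_gt0.
have [N0' HN'] := H _ eta0.
pose N0 := N0'.+2; have HN n : (N0 <= n)%N -> w n <= rho * Num.max (w n./2) (w (n - n./2)%N) +
    eps * (1 - rho) / 2 by move=> h; apply: HN'; apply: leq_trans h; rewrite /N0 ltnW.
pose B : R := \sum_(i < N0) w i + eps.
have B0 : 0 <= \sum_(i < N0) w i by apply: sumr_ge0.
have wB n : w n <= B.
  elim/ltn_ind: n => n IH; case: (ltnP n N0) => nN.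
    apply: le_trans (_ : \sum_(i < N0) w i <= _); last by rewrite /B lerDl ltW.
    by rewrite (bigD1 (Ordinal nN)) //= lerDl sumr_ge0.
  apply: le_trans (HN n nN) _.
  have : Num.max (w n./2) (w (n - n./2)%N) <= B.
    by rewrite ge_max !IH //; move: nN; rewrite /N0; clear; lia.
  move=> /(ler_wpM2l rho0) h.
  have : eps * (1 - rho) <= B * (1 - rho).
    by rewrite ler_wpM2r ?subr_ge0 ?(ltW rho1) // /B lerDr.
  have : 0 <= eps * (1 - rho) by apply: mulr_ge0; rewrite ?subr_ge0 ltW.
  nra.
have wj j n : (2 ^ j * N0 <= n)%N -> w n <= rho ^+ j * B + eps / 2.
  elim: j n => [|j IH] n nj.
    by rewrite expr0 mul1r; apply: le_trans (wB n) _; rewrite lerDl divr_ge0 // ltW.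
  have h1 : (2 ^ j * N0 <= n./2)%N by move: nj; rewrite expnS; set q := (2 ^ j)%N; clear; lia.
  have nN : (N0 <= n)%N.
    apply: leq_trans nj; apply: leq_pmull; rewrite expn_gt0 //.
  apply: le_trans (HN n nN) _.
  have : Num.max (w n./2) (w (n - n./2)%N) <= rho ^+ j * B + eps / 2.
    by rewrite ge_max !IH //; apply: leq_trans h1 _; clear; lia.
  move=> /(ler_wpM2l rho0) h.
  rewrite exprS -[rho * _ * B]mulrA.
  have -> : eps / 2 = rho * (eps / 2) + eps * (1 - rho) / 2 by field.
  by rewrite addrA lerD2r -mulrDr.
have C : (rho ^+ j) @[j --> \oo] --> (0 : R).
  by apply: cvg_expr; rewrite ger0_norm.
have Bp : 0 < B + 1 by rewrite /B; lra.
have d0 : 0 < eps / 2 / (B + 1) by rewrite !divr_gt0.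
have /cvgrPdist_le/(_ _ d0)[J _ HJ] := C.
near=> n.
rewrite sub0r normrN ger0_norm //.
apply: le_trans (wj J n _) _; first by near: n; exact: nbhs_infty_ge.
have := HJ J (leqnn J); rewrite /= sub0r normrN ger0_norm ?exprn_ge0 // ler_pdivlMr // => h.
have : 0 <= rho ^+ J by rewrite exprn_ge0.
nra.
Unshelve. all: by end_near.
Qed.

Lemma var_cap_ratio_cvg (R : realType) :
  var_cap n / mean_cap n ^+ 2 @[n --> \oo] --> (0 : R).
Proof.
have [rho [rho0 rho1 H]] := var_cap_ratio_step R.
apply: (halving_recursion R _ rho rho0 rho1) => // n.
by rewrite divr_ge0 ?var_cap_ge0 ?sqr_ge0.
Qed.

(** * From the law of the walk to finite averages *)

Fixpoint allsteps (n : nat) : seq (seq step) :=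
  if n is m.+1 then [seq e :: s | e <- enum {: step}, s <- allsteps m] else [:: [::]].

Lemma mem_allsteps n s : (s \in allsteps n) = (size s == n).
Proof.
elim: n s => [|n IH] [|e s] //=.
  by apply/allpairsP => -[[e s] []].
rewrite eqSS -IH; apply/allpairsP/idP => [[[e' s'] [_ s'n [_ ->]]] //|sn].
by exists (e, s); rewrite mem_enum.
Qed.

Lemma allsteps_uniq n : uniq (allsteps n).
Proof.
elim: n => [//|n IH] /=; apply: allpairs_uniq; rewrite ?enum_uniq // => -[e s] [e' s'] _ _ /=.
by case=> -> ->.
Qed.

Lemma Ex_allsteps (R : realFieldType) n (F : seq step -> R) :
  Ex n F = \sum_(s <- allsteps n) (8%:R^-1) ^+ n * F s.
Proof.
elim: n F => [|n IH] F; first by rewrite big_seq1 expr0 mul1r.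
rewrite /= big_allpairs_dep big_enum mulr_sumr; apply: eq_bigr => e _.
by rewrite IH mulr_sumr; apply: eq_bigr => s _; rewrite mulrA -exprS.
Qed.

Lemma step_vec_inj : injective step_vec.
Proof.
move=> [i b] [j c] /rowP H; move: (H i) (H j) => {H}.
rewrite /step_vec; case: b; case: c; rewrite /= !mxE !eqxx /= [j == i]eq_sym;
  by case: (eqVneq i j) => [->|].
Qed.

Lemma pos_take_inj s t : size s = size t ->
  (forall i, (i <= size s)%N -> pos (take i s) = pos (take i t)) -> s = t.
Proof.
elim: s t => [|e s IH] [|e' t] //= [st] H.
have ee : e = e'.
  by apply: step_vec_inj; have := H 1%N isT; rewrite /= !take0 !pos_cons !pos_nil !addr0.
rewrite ee (IH t) // => i ni; have := H i.+1 ni; rewrite /= !pos_cons ee.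
exact: addrI.
Qed.

Lemma neighbour_step_vec y e : neighbour y (y + step_vec e).
Proof.
apply/existsP; exists e.1; rewrite /step_vec.
by case: e.2; rewrite eqxx ?orbT.
Qed.

Section walk_law.
Context (R : realType) (disp : measure_display) (T : measurableType disp)
  (P : probability T R) (X : nat -> T -> 'rV[int]_4) (x0 : 'rV[int]_4)
  (hX : is_srw P X x0).

Definition hist (n : nat) (w : T) : seq 'rV[int]_4 := [seq X i w | i <- iota 0 n.+1].

Definition follows (s : seq step) : set T :=
  [set w | forall i, (i <= size s)%N -> X i w = x0 + pos (take i s)].

Lemma measurable_prefix (n : nat) (p : nat -> 'rV[int]_4) :
  measurable [set w | forall i, (i <= n)%N -> X i w = p i].
Proof.
have -> : [set w | forall i, (i <= n)%N -> X i w = p i]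
    = \bigcap_(i in [set i | (i <= n)%N]) [set w | X i w = p i].
  by apply/seteqP; split.
apply: bigcap_measurable; first by exists 0%N.
by move=> i _; exact: (srw_meas hX).
Qed.

Lemma measurable_follows s : measurable (follows s).
Proof. exact: measurable_prefix. Qed.

Lemma prob_follows s : P (follows s) = ((8%:R^-1) ^+ size s)%:E.
Proof.
elim/last_ind: s => [|s e IH].
  rewrite expr0 -(srw_start hX); congr (P _); apply/seteqP; split => w /=.
    by move=> /(_ 0%N isT); rewrite take0 pos_nil addr0.
  by move=> Hw [|i] // _; rewrite take0 pos_nil addr0.
have := srw_jump hX (size s) (fun i => x0 + pos (take i s)) (x0 + pos (rcons s e)).
have -> : srw_step R (x0 + pos (take (size s) s)) (x0 + pos (rcons s e)) = 8%:R^-1.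
  rewrite take_size -cats1 pos_cat pos_cons pos_nil addr0 addrA /srw_step.
  by rewrite neighbour_step_vec.
have -> : [set w | (forall i, (i <= size s)%N -> X i w = x0 + pos (take i s)) /\
    X (size s).+1 w = x0 + pos (rcons s e)] = follows (rcons s e).
  apply/seteqP; split => w /=.
    move=> [H1 H2] i; rewrite size_rcons leq_eqVlt => /orP[/eqP ->|].
      by rewrite take_oversize ?size_rcons.
    by rewrite ltnS => h; rewrite H1 // -cats1 takel_cat.
  move=> H; split => [i h|].
    by rewrite (H i) ?size_rcons ?leqW // -cats1 takel_cat.
  by rewrite (H (size s).+1) ?size_rcons // take_oversize // size_rcons.
move=> ->; rewrite -/(follows s) IH size_rcons -EFinM.
by congr (_%:E); rewrite exprS mulrC.
Qed.

Lemma hist_follows s w : follows s w -> hist (size s) w = traj x0 s.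
Proof.
move=> H; apply: (@eq_from_nth _ 0); first by rewrite size_map size_iota size_traj.
move=> i; rewrite size_map size_iota => ni.
by rewrite (nth_map 0%N) ?size_iota // nth_iota // add0n nth_traj // H.
Qed.

Lemma trivIset_follows n : trivIset [set` allsteps n] follows.
Proof.
move=> s t /=; rewrite !mem_allsteps => /eqP sn /eqP tn [w [ws wt]].
apply: pos_take_inj; first by rewrite sn tn.
move=> i ni; have h := ws i ni.
have := wt i; rewrite tn -sn => /(_ ni); rewrite h; exact: addrI.
Qed.

Lemma measurable_hist n (g : seq 'rV[int]_4 -> R) :
  measurable_fun setT (fun w => (g (hist n w))%:E).
Proof.
move=> _ B mB; rewrite setTI.
have -> : (fun w => (g (hist n w))%:E) @^-1` B
   = \bigcup_(z : seq 'rV[int]_4) [set w | hist n w = z /\ B (g z)%:E].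
  apply/seteqP; split => [w Bw|w [z _ [<-]]] //.
  by exists (hist n w).
apply: countable_bigcupT_measurable; first exact: countableP.
move=> z; have [Bz|nBz] := pselect (B (g z)%:E); last first.
  by rewrite (_ : [set _ | _] = set0) // -subset0 => w [].
have [zn|zn] := eqVneq (size z) n.+1; last first.
  rewrite (_ : [set _ | _] = set0) // -subset0 => w [hz _].
  by move: zn; rewrite -hz size_map size_iota eqxx.
rewrite (_ : [set _ | _] = [set w | forall i, (i <= n)%N -> X i w = nth 0 z i]).
  exact: measurable_prefix.
apply/seteqP; split => w /=.
  move=> [<- _] i ni; rewrite (nth_map 0%N) ?size_iota //.
  by rewrite nth_iota.
move=> H; split => //; apply: (@eq_from_nth _ 0); first by rewrite size_map size_iota.
move=> i; rewrite size_map size_iota => ni.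
by rewrite (nth_map 0%N) ?size_iota // nth_iota // add0n H.
Qed.

(** On each of the finitely many events [follows s] the integrand is
    constant. *)
Lemma integral_follows n (g : seq 'rV[int]_4 -> R) : (forall z, 0 <= g z) ->
  (\int[P]_(w in \big[setU/set0]_(s <- allsteps n) follows s) (g (hist n w))%:E
   = (Ex n (fun s => g (traj x0 s)))%:E)%E.
Proof.
move=> g0; rewrite ge0_integral_bigsetU //.
- rewrite Ex_allsteps -sumEFin big_seq [RHS]big_seq; apply: eq_bigr => s.
  rewrite mem_allsteps => /eqP sn.
  transitivity (\int[P]_(w in follows s) (cst (g (traj x0 s))%:E) w)%E.
    by apply: eq_integral => w; rewrite inE => /hist_follows; rewrite sn => ->.
  rewrite integral_cst; last exact: measurable_follows.
  transitivity ((g (traj x0 s))%:E * ((8%:R^-1) ^+ size s)%:E)%E.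
    by congr (_ * _)%E; exact: prob_follows.
  by rewrite sn -EFinM mulrC.
- exact: measurable_follows.
- exact: allsteps_uniq.
- exact: trivIset_follows.
- apply: measurable_funTS; exact: measurable_hist.
- by move=> w _; rewrite lee_fin.
Qed.

(** The events [follows s] with s of length n exhaust the probability, so
    integrals of functionals of the trajectory are finite averages. *)
Lemma integral_hist n (g : seq 'rV[int]_4 -> R) : (forall z, 0 <= g z) ->
  (\int[P]_w (g (hist n w))%:E = (Ex n (fun s => g (traj x0 s)))%:E)%E.
Proof.
move=> g0; rewrite -integral_follows //.
set D := \big[setU/set0]_(s <- allsteps n) follows s.
have mD : measurable D by apply: bigsetU_measurable => s _; exact: measurable_follows.
have PD : P D = 1%E.
  have := integral_follows n (fun=> 1) (fun=> ler01); rewrite -/D.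
  rewrite -/(cst 1%E) integral_cst // mul1e => ->.
  by rewrite Ex_cst.
rewrite (ge0_negligible_integral (N := ~` D)) //.
- by rewrite setTD setCK.
- exact: measurableC.
- exact: measurable_hist.
- by move=> w _; rewrite lee_fin.
- by rewrite /= probability_setC // PD subee.
Qed.

Lemma measurable_hist_set n (Q : pred (seq 'rV[int]_4)) : measurable [set w | Q (hist n w)].
Proof.
have := measurable_hist n (fun z => (Q z)%:R).
move=> /(_ measurableT [set 1%E] (emeasurable_set1 _)); rewrite setTI.
congr (measurable _); apply/seteqP; split => w /=; case: (Q _) => //.
by case=> /eqP; rewrite eq_sym oner_eq0.
Qed.

Lemma prob_hist n (Q : pred (seq 'rV[int]_4)) :
  P [set w | Q (hist n w)] = (Ex n (fun s => (Q (traj x0 s))%:R))%:E.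
Proof.
rewrite -(integral_hist n (fun z => (Q z)%:R)); last by move=> z; rewrite ler0n.
rewrite -[in LHS](setIT [set w | _]) -integral_indic //; last exact: measurable_hist_set.
by apply: eq_integral => w _; rewrite indicE; congr (_%:R%:E); rewrite mem_setE.
Qed.

End walk_law.

Lemma avoid_traj A x s : avoid A x s = all (fun y => y \notin A) (behead (traj x s)).
Proof.
elim: s x => [//|e s IH] x /=; rewrite IH.
by case: s {IH} => [|e' s] /=.
Qed.

(** Continuity from above: never returning to F is the decreasing
    intersection of not returning up to time n. *)
Lemma escape_esc (R : realType) (disp : measure_display) (Omega : measurableType disp)
    (Px : 'rV[int]_4 -> probability Omega R) (Y : nat -> Omega -> 'rV[int]_4)
    (hY : srw_family Px Y) (F : {fset 'rV[int]_4}) x :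
  escape Px Y F x = esc (enum_fset F) x.
Proof.
pose S n := [set w | forall m, (1 <= m <= n)%N -> Y m w \notin F].
pose Q (z : seq 'rV[int]_4) := all (fun y => y \notin enum_fset F) (behead z).
have SE n : S n = [set w | Q (hist disp Omega Y n w)].
  apply/seteqP; split => w; rewrite /Q /hist /=.
    move=> H; apply/allP => y /mapP[m]; rewrite mem_iota add1n => /andP[m1 m2] ->.
    by apply: H; rewrite m1 -ltnS.
  move=> /allP H m /andP[m1 m2]; apply: H; apply: map_f.
  by rewrite mem_iota add1n m1 ltnS.
have PS n : Px x (S n) = (esc_upto (enum_fset F) n x : R)%:E.
  rewrite SE (prob_hist _ _ _ _ _ _ (hY x)); congr (_%:E).
  by apply: Ex_ext => s _; rewrite avoid_traj.
have mS n : measurable (S n) by rewrite SE; exact: (measurable_hist_set _ _ _ _ _ _ (hY x)).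
have E : [set w | forall m, (1 <= m)%N -> Y m w \notin F] = \bigcap_n S n.
  apply/seteqP; split => w H.
    by move=> n _ m /andP[m1 _]; exact: H.
  by move=> m m1; apply: (H m) => //; rewrite m1 leqnn.
rewrite /escape E.
have C : (Px x \o S) n @[n --> \oo] --> Px x (\bigcap_n S n).
  apply: nonincreasing_cvg_mu => //.
  - by apply: (@le_lt_trans _ _ 1%E); [exact: probability_le1 | exact: ltry].
  - exact: bigcapT_measurable.
  - apply/nonincreasing_seqP => n; apply/subsetPset => w H m /andP[m1 m2].
    by apply: H; rewrite m1 leqW.
have C' : (Px x \o S) n @[n --> \oo] --> (esc (enum_fset F) x : R)%:E.
  rewrite (_ : Px x \o S = EFin \o (fun n => esc_upto (enum_fset F) n x)); last first.
    by apply/funext => n /=; exact: PS.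
  by apply: cvg_EFin; [exact: nearW | exact: esc_cvg].
by rewrite (cvg_unique _ C C').
Qed.

(** * Mean and variance under the law of the walk *)

Lemma capacity_cap (R : realType) (disp : measure_display) (Omega : measurableType disp)
    (Px : 'rV[int]_4 -> probability Omega R) (Y : nat -> Omega -> 'rV[int]_4)
    (hY : srw_family Px Y) (dT : measure_display) (T : measurableType dT)
    (X : nat -> T -> 'rV[int]_4) n w :
  capacity Px Y (walk_range X n w) = cap (hist dT T X n w).
Proof.
set F := walk_range X n w.
have FE : enum_fset F =i hist dT T X n w.
  move=> y; rewrite -[LHS]/(y \in F) /F /walk_range.
  apply/idP/idP => [/imfsetP[i /= iI ->]|/mapP[i iI ->]]; first exact: map_f.
  by apply/imfsetP; exists i.
rewrite -(cap_eq_mem _ _ _ FE) /capacity /cap undup_id ?fset_uniq //.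
by apply: eq_bigr => x _; exact: escape_esc.
Qed.

Lemma var_cap_chebyshev (R : realType) n (eps : R) : 0 < eps ->
  Ex n (fun s => (eps < `|walkcap s / mean_cap n - 1| :> R)%R%:R)
  <= var_cap n / mean_cap n ^+ 2 / eps ^+ 2.
Proof.
move=> eps0; have m0 := mean_cap_gt0 R n.
rewrite var_capE -!ExZr; apply: Ex_le => s _; case: ltP => H /=; last first.
  by apply: divr_ge0; [apply: divr_ge0|]; exact: sqr_ge0.
rewrite ler_pdivlMr ?exprn_gt0 // mul1r -expr_div_n.
have -> : (walkcap s - mean_cap n) / mean_cap n = walkcap s / mean_cap n - 1 :> R.
  by rewrite mulrBl divff // gt_eqF.
by rewrite -[leRHS]real_normK ?num_real // ler_sqr ?nnegrE ?normr_ge0 ?(ltW eps0) // ltW.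
Qed.

Theorem theorem1p1 (R : realType)
    (dO : measure_display) (Omega : measurableType dO)
    (Px : 'rV[int]_4 -> probability Omega R) (Y : nat -> Omega -> 'rV[int]_4)
    (hY : srw_family Px Y)
    (dT : measure_display) (T : measurableType dT) (P : probability T R)
    (X : nat -> T -> 'rV[int]_4) (x0 : 'rV[int]_4) (hX : is_srw P X x0) :
  let C (n : nat) (w : T) : R := capacity Px Y (walk_range X n w) in
  (fine 'V_P[C n] / (fine 'E_P[C n]) ^+ 2 @[n --> \oo] --> (0 : R)) /\
  cvg_in_probability P (fun n w => C n w / fine 'E_P[C n]) 1.
Proof.
move=> C.
have CE n w : C n w = cap (hist dT T X n w) by exact: capacity_cap.
have EC n : fine 'E_P[C n] = mean_cap n.
  rewrite expectation.unlock; under eq_integral => w _ do rewrite CE.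
  rewrite (integral_hist _ _ _ _ _ _ hX n cap) /=; last by move=> z; exact: cap_ge0.
  by apply: Ex_ext => s _; exact: cap_traj.
have VC n : fine 'V_P[C n] = var_cap n.
  rewrite /variance covariance.unlock EC expectation.unlock.
  rewrite var_capE (eq_integral (fun w => ((cap (hist dT T X n w) - mean_cap n) ^+ 2)%:E)); last first.
    by move=> w _; rewrite -CE expr2.
  rewrite (integral_hist _ _ _ _ _ _ hX n (fun z => (cap z - mean_cap n) ^+ 2)) /=; last first.
    by move=> z; exact: sqr_ge0.
  by apply: Ex_ext => s _; rewrite cap_traj.
split.
  by under eq_fun do rewrite VC EC; exact: var_cap_ratio_cvg.
move=> eps eps0.
pose p n : R := Ex n (fun s => (eps < `|walkcap s / mean_cap n - 1| :> R)%R%:R).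
have Pp n : P [set w | eps < `|C n w / fine 'E_P[C n] - 1|] = (p n)%:E.
  have -> : [set w | eps < `|C n w / fine 'E_P[C n] - 1|]
     = [set w | (fun z => eps < `|cap z / mean_cap n - 1|) (hist dT T X n w)].
    by apply/seteqP; split => w /=; rewrite EC CE.
  rewrite (prob_hist _ _ _ _ _ _ hX n (fun z => eps < `|cap z / mean_cap n - 1|)).
  by congr (_%:E); apply: Ex_ext => s _; rewrite cap_traj.
under eq_fun do rewrite Pp.
apply: cvg_EFin; first exact: nearW.
apply: (@squeeze_cvgr _ _ _ _ (fun=> 0) (fun n => var_cap n / mean_cap n ^+ 2 / eps ^+ 2)).
- apply: nearW => n; rewrite var_cap_chebyshev // andbT.
  by apply: Ex_ge0 => s _; rewrite ler0n.
- exact: cvg_cst.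
- rewrite -[X in _ --> X](mul0r (eps ^+ 2)^-1).
  by apply: cvgM; [exact: var_cap_ratio_cvg | exact: cvg_cst].
Qed.
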